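(* Let $\Bbbk$ be an arbitrary field. There exists a non-cone simplicial complex $\Delta$ with $\dim\Delta=d-1\geq 2$ such that, with $S$ the polynomial ring over $\Bbbk$ on the vertex set of $\Delta$, the following conditions are satisfied: (1) $\Delta$ is pure and shellable; (2) $S/I_{\Delta}^{(2)}$ is Cohen–Macaulay; (3) $\mathrm{depth}(S/I_{\Delta}^{(d+1)})=1$ and $\mathrm{depth}(S/I_{\Delta}^{(d+2)})\geq2$; (4) $S_{2}\text{-}\mathrm{depth}(S/I_{\Delta}^{(d+1)})=1$ and $S_{2}\text{-}\mathrm{depth}(S/I_{\Delta}^{(d+2)})\geq2$.
   Context: Let $S=\Bbbk[x_1,\dots,x_n]$, $\mathfrak m=(x_1,\dots,x_n)$, $\omega_S$ the canonical module. For an unmixed finitely generated graded $S$-module $M$ and $r\ge 2$, $S_r\text{-}\mathrm{depth}(M)=\min\{j : \dim K_M^j\ge j-r+1\}$, where $K_M^j=\mathrm{Hom}_{\Bbbk}(H^j_{\mathfrak m}(M),\Bbbk)\cong \mathrm{Ext}_S^{n-j}(M,\omega_S)$, $\dim$ is Krull dimension, and $\dim 0=-\infty$. $\dim F=|F|-1$ for a face $F$, and $\dim\Delta$ is the maximal dimension of a face; $\Delta$ is pure if all facets have the same dimension; $\Delta$ is a cone if some vertex lies in every facet. $\Delta$ is shellable if its facets can be ordered $F_1,\dots,F_m$ so that for all $2\le j\le m$ the subcomplex $\langle F_1,\dots,F_{j-1}\rangle\cap\langle F_j\rangle$ is pure of dimension $\dim F_j-1$. The Stanley–Reisner ideal $I_\Delta\subset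 S$ is generated by the squarefree monomials corresponding to minimal non-faces of $\Delta$. For a squarefree monomial ideal $I$, the $\ell$-th symbolic power is $I^{(\ell)}=\bigcap_{P\in\mathrm{Ass}(I)}P^\ell$. *)

(* Defs.v *)
From mathcomp Require Import all_boot all_order all_algebra.
From mathcomp Require Import mpoly.

Set Implicit Arguments.
Unset Strict Implicit.
Unset Printing Implicit Defensive.

Import GRing.Theory.
Local Open Scope ring_scope.

Section Complexes.

Variable n : nat.
Implicit Types (Delta : {set {set 'I_n}}) (F : {set 'I_n}).

(* The last condition says that every element of 'I_n is a vertex. *)
Definition simplicial_complex Delta : Prop :=
  [/\ set0 \in Delta,
      forall F G : {set 'I_n}, F \in Delta -> G \subset F -> G \in Delta
    & forall i : 'I_n, [set i] \in Delta].

Definition face_dim F : int := #|F|%:Z - 1.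

Definition complex_dim Delta : int := (\max_(F in Delta) #|F|)%:Z - 1.

Definition facets Delta : {set {set 'I_n}} :=
  [set F | maxset (fun G => G \in Delta) F].

Definition pure Delta : Prop :=
  {in facets Delta &, forall F G, face_dim F = face_dim G}.

Definition cone Delta : Prop :=
  exists v : 'I_n, {in facets Delta, forall F, v \in F}.

Definition generated_complex (s : seq {set 'I_n}) : {set {set 'I_n}} :=
  [set G : {set 'I_n} | has (fun F : {set 'I_n} => G \subset F) s].

Definition shellable Delta : Prop :=
  exists s : seq {set 'I_n},
    [/\ uniq s, s =i facets Delta
      & forall j, (0 < j < size s)%N ->
          let Fj := nth set0 s j in
          let Gamma :=
            generated_complex (take j s) :&: generated_complex [:: Fj] in
          pure Gamma /\ complex_dim Gamma = face_dim Fj - 1].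

End Complexes.

(* Ideals are Prop-valued predicates.  An ideal J also stands for the cyclic
   module S/J: depth, local cohomology, etc. of J below are those of S/J. *)
Section Ideals.

Variable R : comNzRingType.
Implicit Types (I P G : R -> Prop).

Definition is_ideal I : Prop :=
  [/\ I 0, forall f g, I f -> I g -> I (f + g) & forall a f, I f -> I (a * f)].

Definition is_prime P : Prop :=
  [/\ is_ideal P, ~ P 1 & forall f g, P (f * g) -> P f \/ P g].

Definition ideal_span G (f : R) : Prop :=
  exists s : seq (R * R),
    (forall u, u \in s -> G u.2) /\ f = \sum_(u <- s) u.1 * u.2.

Definition ideal_pow I (l : nat) : R -> Prop :=
  ideal_span (fun f => exists g : 'I_l -> R,
    (forall i, I (g i)) /\ f = \prod_(i < l) g i).

Definition associated_prime I P : Prop :=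
  is_prime P /\ exists f, forall g, P g <-> I (g * f).

Definition symbolic_power I (l : nat) (f : R) : Prop :=
  forall P, associated_prime I P -> ideal_pow P l f.

(* a chain P_0 < ... < P_l of primes containing I *)
Definition prime_chain I (l : nat) : Prop :=
  exists P : nat -> R -> Prop,
    [/\ forall i, (i <= l)%N -> is_prime (P i),
        forall f, I f -> P 0%N f
      & forall i, (i < l)%N ->
          (forall f, P i f -> P i.+1 f) /\ exists f, P i.+1 f /\ ~ P i f].

(* dim R/I = l *)
Definition krull_dim_eq I (l : nat) : Prop :=
  prime_chain I l /\ forall l', prime_chain I l' -> (l' <= l)%N.

(* dim R/I >= m; false for every m when I = R, in accordance with
   dim 0 = -oo. *)
Definition krull_dim_ge I (m : int) : Prop :=
  exists l : nat, prime_chain I l /\ m <= l%:Z.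

End Ideals.

Section PolynomialRing.

Variables (k : fieldType) (n : nat).
Local Notation S := {mpoly k[n]}.
Local Notation FracS := {fraction S}.
Implicit Types (J : S -> Prop) (c : {ffun {set 'I_n} -> FracS}).

Definition monomial_of (A : {set 'I_n}) : S := \prod_(i in A) 'X_i.

Definition Stanley_Reisner (Delta : {set {set 'I_n}}) : S -> Prop :=
  ideal_span (fun f => exists A : {set 'I_n},
    minset (fun B => B \notin Delta) A /\ f = monomial_of A).

Definition max_ideal : S -> Prop :=
  ideal_span (fun f => exists i : 'I_n, f = 'X_i).

(* J + (s) *)
Definition ideal_add J (s : seq S) : S -> Prop :=
  ideal_span (fun f => J f \/ f \in s).

(* s is an (S/J)-regular sequence contained in the ideal (x_1, ..., x_n) *)
Definition regular_sequence J (s : seq S) : Prop :=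
  [/\ forall i, (i < size s)%N -> max_ideal s`_i,
      forall i, (i < size s)%N ->
        forall g, ideal_add J (take i s) (s`_i * g) -> ideal_add J (take i s) g
    & ~ ideal_add J s 1].

Definition depth_ge J (t : nat) : Prop :=
  exists s, regular_sequence J s /\ (t <= size s)%N.

Definition depth_eq J (t : nat) : Prop :=
  (exists s, regular_sequence J s /\ size s = t) /\
  (forall s, regular_sequence J s -> (size s <= t)%N).

Definition cohen_macaulay J : Prop :=
  exists t, depth_eq J t /\ krull_dim_eq J t.

(* Local cohomology of S/J as the cohomology of its Cech complex on
   x_1, ..., x_n, whose p-th term is the sum over |sigma| = p of the
   localizations of S/J at x_sigma = \prod_(i in sigma) x_i.  Such a
   localization is the quotient of S[1/x_sigma], inside the fraction field of S,
   by the extension of J. *)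
Definition in_localization J (sigma : {set 'I_n}) (q : FracS) : Prop :=
  exists (f : S) (N : nat),
    J f /\ q = tofrac f / tofrac (monomial_of sigma ^+ N).

Definition whole_ring : S -> Prop := fun=> True.

(* With I = whole_ring these are the p-cochains of S (families over
   |sigma| = p, extended by zero); with I = J those vanishing in the
   p-cochains of S/J. *)
Definition cech_cochain (I : S -> Prop) (p : nat) c : Prop :=
  forall sigma : {set 'I_n},
    if #|sigma| == p then in_localization I sigma (c sigma) else c sigma = 0.

Definition cech_diff c : {ffun {set 'I_n} -> FracS} :=
  [ffun tau : {set 'I_n} => \sum_(i in tau)
     (-1) ^+ #|[set j in tau | (j < i)%N]| * c (tau :\ i)].

Definition cech_cocycle J (p : nat) c : Prop :=
  cech_cochain whole_ring p c /\ cech_cochain J p.+1 (cech_diff c).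

(* Only b = 0 is allowed when p = 0. *)
Definition cech_coboundary J (p : nat) c : Prop :=
  exists b : {ffun {set 'I_n} -> FracS},
    (forall sigma : {set 'I_n},
       if #|sigma|.+1 == p then in_localization whole_ring sigma (b sigma)
       else b sigma = 0) /\
    cech_cochain J p (c - cech_diff b).

Definition cochain_scale (f : S) c : {ffun {set 'I_n} -> FracS} :=
  [ffun sigma => tofrac f * c sigma].

Definition cochain_homogeneous (e : int) c : Prop :=
  forall sigma : {set 'I_n},
    c sigma = 0 \/
    exists (f : S) (m N : nat),
      [/\ f \is m.-homog, e = m%:Z - (N * #|sigma|)%:Z
        & c sigma = tofrac f / tofrac (monomial_of sigma ^+ N)].

(* The elements of K^j = Hom_k(H^j_m(S/J), k), for J homogeneous: k-linear forms
   on the j-cocycles that vanish on the j-coboundaries.  As usual for graded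
   modules, Hom_k is the graded dual (the full dual would not be Ext): a form
   lives in finitely many degrees.  Only the values of phi on cocycles are
   meaningful. *)
Definition dual_local_cohomology J (j : nat)
    (phi : {ffun {set 'I_n} -> FracS} -> k) : Prop :=
  [/\ forall (a : k) c c', cech_cocycle J j c -> cech_cocycle J j c' ->
        phi (cochain_scale a%:MP c + c') = a * phi c + phi c',
      forall c, cech_cocycle J j c -> cech_coboundary J j c -> phi c = 0
    & exists N : nat, forall (e : int) c, N%:Z < `|e| ->
        cech_cocycle J j c -> cochain_homogeneous e c -> phi c = 0].

(* the annihilator of K^j, where (f phi)(z) = phi(f z) *)
Definition ann_dual J (j : nat) (f : S) : Prop :=
  forall phi, dual_local_cohomology J j phi ->
    forall c, cech_cocycle J j c -> phi (cochain_scale f c) = 0.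

(* dim K^j >= m, the dimension of a finitely generated module being that of S
   modulo its annihilator *)
Definition dual_dim_ge J (j : nat) (m : int) : Prop :=
  krull_dim_ge (ann_dual J j) m.

Definition Serre_depth_eq (r : nat) J (t : nat) : Prop :=
  dual_dim_ge J t (t%:Z - r%:Z + 1) /\
  forall j : nat, dual_dim_ge J j (j%:Z - r%:Z + 1) -> (t <= j)%N.

(* The minimum is over a nonempty set as soon as J is proper, so this says that
   S_r-depth(S/J) >= t. *)
Definition Serre_depth_ge (r : nat) J (t : nat) : Prop :=
  forall j : nat, dual_dim_ge J j (j%:Z - r%:Z + 1) -> (t <= j)%N.

End PolynomialRing.

Arguments Stanley_Reisner k [n] Delta _.

(* Main.v *)
(* The complex is the cone with apex 6 over the complete graph on {0, ..., 5},
   together with the triangles T = {0, 1, 2} and U = {3, 4, 5}; so d = 3. A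
   monomial X^m lies outside the l-th symbolic power iff wt F m < l for some facet
   F, where wt F m is the degree of m off F; these F span the degree complex at m.

   For l = 2, S/I^(l) has a filtration whose quotients are shifts of the S/P_F, F a
   facet, and the elementary symmetric polynomials e1, e2, e3 are a regular
   sequence on each of them. Depth and dimension are at most 3 because a longer
   regular sequence or chain of primes would yield 4 elements algebraically
   independent modulo I^(2), while the monomials outside I^(2) grow cubically.

   For l = 4 and m the indicator of T and U, the degree complex is the disjoint
   union of T and U, and adding any vertex to m destroys one of them: this gives
   a socle element of H^1, which forces depth 1 and yields a nonzero form on H^1.

   For l = 5 any two facets of a degree complex meet a common third one, so
   polynomials given on the components S/P_F^l glue as soon as they agree for
   facets that meet. Hence e1, e2 is a regular sequence and H^0 = H^1 = 0. With
   r = 2, the Serre depth is at least 2 iff K^0 = K^1 = 0. *)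
Require Import Defs.
From mathcomp Require Import all_boot all_order all_algebra.
From mathcomp Require Import mpoly.
From mathcomp Require Import ring zify.
From Stdlib Require Import FunctionalExtensionality PropExtensionality ClassicalEpsilon.

Set Implicit Arguments.
Unset Strict Implicit.
Unset Printing Implicit Defensive.

Import GRing.Theory.
Local Open Scope ring_scope.

(** * Ideals and regular sequences *)

Lemma predeqP (T : Type) (P Q : T -> Prop) : (forall x, P x <-> Q x) -> P = Q.
Proof.
by move=> PQ; apply: functional_extensionality => x; apply: propositional_extensionality.
Qed.

Section IdealTheory.
Variable R : comNzRingType.
Implicit Types I G : R -> Prop.

Lemma ideal_opp I f : is_ideal I -> I f -> I (- f).
Proof. by case=> _ _ IM If; rewrite -mulN1r; apply: IM. Qed.

Lemma ideal_sub I f g : is_ideal I -> I f -> I g -> I (f - g).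
Proof. by move=> idI If Ig; case: (idI) => _ ID _; apply: ID => //; apply: ideal_opp. Qed.

Lemma ideal_sum I (T : Type) (r : seq T) (P : pred T) (F : T -> R) :
  is_ideal I -> (forall i, P i -> I (F i)) -> I (\sum_(i <- r | P i) F i).
Proof.
move=> [I0 ID _] IF; elim/big_rec: _ => // i x Pi Ix.
exact: ID (IF i Pi) Ix.
Qed.

Lemma ideal_span_ideal G : is_ideal (ideal_span G).
Proof.
split=> [|f g [s [sG ->]] [t [tG ->]]|a f [s [sG ->]]].
- by exists [::]; rewrite big_nil.
- exists (s ++ t); rewrite big_cat; split=> // u.
  by rewrite mem_cat => /orP[/sG|/tG].
- exists [seq (a * u.1, u.2) | u <- s]; split=> [_ /mapP[u us ->]|]; first exact: (sG _ us).
  by rewrite big_map mulr_sumr; apply: eq_bigr => u _; rewrite mulrA.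
Qed.

Lemma ideal_span_gen G f : G f -> ideal_span G f.
Proof.
move=> Gf; exists [:: (1, f)]; rewrite big_seq1 mul1r; split=> // u.
by rewrite inE => /eqP->.
Qed.

Lemma ideal_span_min G I f :
  is_ideal I -> (forall g, G g -> I g) -> ideal_span G f -> I f.
Proof.
move=> idI GI [s [sG ->]]; rewrite big_seq; apply: ideal_sum => // u us.
by case: idI => _ _ IM; apply: IM; apply: GI; apply: sG.
Qed.

Lemma prime_ideal_prod P (T : Type) (r : seq T) (Q : pred T) (F : T -> R) :
  is_prime P -> P (\prod_(i <- r | Q i) F i) -> exists2 i, Q i & P (F i).
Proof.
case=> _ P1 PM; elim: r => [|i r IH]; rewrite ?big_nil // big_cons.
by case: ifP => // Qi /PM [Pi|/IH //]; exists i.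
Qed.

End IdealTheory.

(** * Regular sequences modulo an ideal of a polynomial ring *)

Section Regular.
Variables (k : fieldType) (n : nat).
Local Notation S := {mpoly k[n]}.
Implicit Types (J L P : S -> Prop) (s : seq S).

Lemma ideal_add_ideal J s : is_ideal (ideal_add J s).
Proof. exact: ideal_span_ideal. Qed.

Lemma ideal_addW J s f : J f -> ideal_add J s f.
Proof. by move=> Jf; apply: ideal_span_gen; left. Qed.

Lemma ideal_add_mem J s f : f \in s -> ideal_add J s f.
Proof. by move=> fs; apply: ideal_span_gen; right. Qed.

Lemma ideal_add_nil J : is_ideal J -> ideal_add J [::] = J.
Proof.
move=> idJ; apply: predeqP => f; split; last exact: ideal_addW.
by apply: ideal_span_min => // g [].
Qed.

Lemma ideal_add_cons J t s :
  ideal_add J (t :: s) = ideal_add (ideal_add J [:: t]) s.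
Proof.
apply: predeqP => f; split; apply: ideal_span_min; try exact: ideal_add_ideal.
- move=> g [Jg|]; first by do 2 apply: ideal_addW.
  rewrite inE => /orP[/eqP->|gs]; last exact: ideal_add_mem.
  by apply/ideal_addW/ideal_add_mem; rewrite mem_head.
- move=> g [|gs]; last by apply: ideal_add_mem; rewrite inE gs orbT.
  apply: ideal_span_min; first exact: ideal_add_ideal.
  move=> h [/ideal_addW //|]; rewrite inE => /eqP->.
  by apply: ideal_add_mem; rewrite mem_head.
Qed.

Lemma ideal_add1P J t f : is_ideal J ->
  ideal_add J [:: t] f <-> exists g, J (f - t * g).
Proof.
move=> idJ; case: (idJ) => J0 JD JM; split; last first.
  case=> g Jg; rewrite -[f](subrK (t * g)).
  case: (ideal_add_ideal J [:: t]) => _ D M.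
  by apply: D; [apply: ideal_addW | rewrite mulrC; apply/M/ideal_add_mem/mem_head].
apply: (ideal_span_min (I := fun f => exists g, J (f - t * g))); last first.
  move=> g [Jg|]; first by exists 0; rewrite mulr0 subr0.
  by rewrite inE => /eqP->; exists 1; rewrite mulr1 subrr.
split=> [|f1 f2 [g1 H1] [g2 H2]|a f1 [g1 H1]].
- by exists 0; rewrite mulr0 subr0.
- by exists (g1 + g2); rewrite mulrDr opprD addrACA; apply: JD.
- by exists (a * g1); rewrite mulrCA -mulrBr; apply: JM.
Qed.

Definition nonzerodivisor J (t : S) := forall g, J (t * g) -> J g.

(** Regularity without properness, in recursive form: an induction on the sequence may then change
    the ideal, and the condition holds trivially modulo the unit ideal. *)
Fixpoint weakly_regular J s : Prop :=
  if s is t :: s' then nonzerodivisor J t /\ weakly_regular (ideal_add J [:: t]) s'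
  else True.

Lemma weakly_regular_cat J s s' :
  weakly_regular J (s ++ s') -> weakly_regular J s.
Proof. by elim: s J => //= t s IH J [? /IH]. Qed.

Lemma weakly_regularP J s : is_ideal J ->
  weakly_regular J s <->
  forall i, (i < size s)%N -> forall g,
    ideal_add J (take i s) (s`_i * g) -> ideal_add J (take i s) g.
Proof.
elim: s J => //= t s IH J idJ; rewrite IH; last exact: ideal_add_ideal.
split=> [[reg_t reg_s] [|i] lti g|reg].
- by rewrite take0 ideal_add_nil //; apply: reg_t.
- by rewrite /= ideal_add_cons; apply: reg_s.
- split=> [g|i lti g]; first by have := reg 0%N erefl g; rewrite take0 ideal_add_nil.
  by have := reg i.+1 lti g; rewrite /= ideal_add_cons.
Qed.

Lemma mcoeff0_ideal : is_ideal (fun f : S => f@_0 = 0).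
Proof.
split=> [|f g f0 g0|a f f0]; rewrite ?mcoeff0 ?mcoeffD ?f0 ?g0 ?addr0 //.
by rewrite rmorphM /= f0 mulr0.
Qed.

Lemma max_idealP (f : S) : max_ideal f -> f@_0 = 0.
Proof.
apply: (ideal_span_min mcoeff0_ideal).
by move=> g [i ->]; rewrite mcoeffX mnm1_eq0.
Qed.

Lemma regular_sequence_intro J s : is_ideal J ->
  (forall f, J f -> f@_0 = 0) -> (forall f, f \in s -> max_ideal f) ->
  weakly_regular J s -> regular_sequence J s.
Proof.
move=> idJ J0 s0 /weakly_regularP reg; split; last 1 first.
- suff H f : ideal_add J s f -> f@_0 = 0.
    by move=> /H /eqP; rewrite mcoeff1 eqxx oner_eq0.
  apply: (ideal_span_min mcoeff0_ideal).
  by move=> g [/J0|/s0/max_idealP].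
- by move=> i lti; apply/s0/mem_nth.
- exact: reg.
Qed.

(* The depth lemma for 0 -> S/P -> S/L -> S/L' -> 0, where the first map is
   multiplication by w. *)
Lemma weakly_regular_extension L L' P w s :
  is_ideal L -> is_ideal P ->
  L' = ideal_add L [:: w] -> (forall f, P f <-> L (w * f)) ->
  weakly_regular P s -> weakly_regular L' s -> weakly_regular L s.
Proof.
elim: s L L' P => //= t s IH L L' P idL idP eqL' colon [regPt regP] [regLt regL].
case: (idL) => L0 LD LM.
(* If t g is in L, then g = w h modulo L because t is regular modulo L'; then w t h is in L, so t h
   and hence h lie in P. *)
have regt : nonzerodivisor L t.
  move=> g Ltg; have : L' g by apply: regLt; rewrite eqL'; apply: ideal_addW.
  rewrite eqL' => /(ideal_add1P _ _ idL) [h Lh].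
  rewrite -[g](subrK (w * h)); apply: LD => //; apply/colon/regPt/colon.
  have -> : w * (t * h) = t * g - t * (g - w * h) by ring.
  by apply: ideal_sub => //; apply: LM.
split=> //; apply: IH regP regL; try exact: ideal_add_ideal.
  rewrite eqL' -!ideal_add_cons; apply: predeqP => f.
  by split; apply: ideal_span_min; try exact: ideal_add_ideal; move=> g [Lg|];
    rewrite ?inE; [exact: ideal_addW | move=> gs; apply: ideal_add_mem; rewrite !inE orbC
    |exact: ideal_addW | move=> gs; apply: ideal_add_mem; rewrite !inE orbC].
(* The colon of L + (t) by w is P + (t): if w f - t g lies in L, then t g and so g lie in L', and
   writing g = w h modulo L gives f - t h in P. *)
move=> f; rewrite (ideal_add1P _ _ idP) (ideal_add1P _ _ idL).
split=> [[g /colon]|[g Lg]].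
  by move=> H; exists (w * g); rewrite mulrCA -mulrBr.
have : L' g.
  apply: regLt; rewrite eqL'; apply/ideal_add1P => //; exists f.
  by rewrite -opprB; apply: ideal_opp.
rewrite eqL' => /(ideal_add1P _ _ idL) [h Lh]; exists h; apply/colon.
have -> : w * (f - t * h) = (w * f - t * g) + t * (g - w * h) by ring.
by apply: LD => //; apply: LM.
Qed.

End Regular.

(** * Monomial ideals and clean filtrations *)

Section MonomialIdeals.
Variables (k : fieldType) (n : nat).
Local Notation S := {mpoly k[n]}.
Local Notation mnm := 'X_{1..n}.
Implicit Types (E : pred mnm) (A : {set 'I_n}) (f g : S) (m w c : mnm).

Definition wt A m : nat := (\sum_(i | i \notin A) m i)%N.

Lemma wtD A m c : wt A (m + c)%MM = (wt A m + wt A c)%N.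
Proof. by rewrite /wt -big_split; apply: eq_bigr => i _; rewrite mnmDE. Qed.

Lemma wt_gt0P A m : reflect (exists2 i, i \notin A & (0 < m i)%N) (0 < wt A m)%N.
Proof.
apply: (iffP idP) => [|[i iA mi]]; last first.
  by rewrite /wt (bigD1 i) //=; apply: leq_trans mi (leq_addr _ _).
rewrite lt0n sum_nat_eq0 negb_forall => /existsP[i].
by rewrite negb_imply -lt0n => /andP[]; exists i.
Qed.

Lemma wt_eq0P A m : reflect (forall i, i \notin A -> m i = 0%N) (wt A m == 0%N).
Proof.
rewrite sum_nat_eq0; apply: (iffP forall_inP) => H i iA; first exact/eqP/H.
by rewrite H.
Qed.

Lemma wtU A i : wt A U_(i)%MM = (i \notin A).
Proof.
case: (boolP (i \in A)) => iA /=.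
  by apply/eqP/wt_eq0P => j jA; rewrite mnm1E; case: eqP jA => // <-; rewrite iA.
rewrite /wt (bigD1 i) //= mnm1E eqxx big1 // => j /andP[_ /negbTE].
by rewrite mnm1E eq_sym => ->.
Qed.

Lemma subm1K m i : (0 < m i)%N -> (m = U_(i) + (m - U_(i)))%MM.
Proof.
move=> mi; apply/mnmP => j; rewrite mnmDE mnmBE mnm1E.
by case: eqP => [<-|_] /=; rewrite ?subnKC // add0n subn0.
Qed.

Definition upclosed E := forall m c, E m -> E (m + c)%MM.

(** For [upclosed E] this is the monomial ideal spanned by the X^m with [E m]; membership is read
    off the coefficients. *)
Definition mideal E f := forall m, ~~ E m -> f@_m = 0.

Lemma eq_mideal E E' : E =1 E' -> mideal E = mideal E'.
Proof. by move=> eqE; apply: predeqP => f; split=> H m; [rewrite -eqE|rewrite eqE]; apply: H. Qed.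

Lemma mcoeffXM w f m :
  ('X_[w] * f)@_m = if (w <= m)%MM then f@_(m - w) else 0.
Proof.
rewrite mulrC; case: ifP => wm; first by rewrite -{1}(submK wm) addmC mcoeffMX.
apply/eqP; rewrite mcoeff_eq0 (perm_mem (msuppMX _ _)); apply/mapP => -[c _ mE].
by rewrite mE lem_addr in wm.
Qed.

Lemma mcoeffXMD w f m : ('X_[w] * f)@_(w + m) = f@_m.
Proof. by rewrite mulrC mcoeffMX. Qed.

Lemma mcoeffMXD w f m : (f * 'X_[w])@_(m + w) = f@_m.
Proof. by rewrite mulrC addmC mcoeffXMD. Qed.

Lemma mideal_ideal E : upclosed E -> is_ideal (mideal E).
Proof.
move=> upE; have idD : forall f g, mideal E f -> mideal E g -> mideal E (f + g).
  by move=> f g Ef Eg m Em; rewrite mcoeffD Ef // Eg // addr0.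
split=> // [m _|a f Ef]; first by rewrite mcoeff0.
rewrite (mpolyE a) mulr_suml; elim/big_rec: _ => [m _|w x _ Ex]; first by rewrite mcoeff0.
apply: idD => // m Em; rewrite -scalerAl mcoeffZ mcoeffXM; case: ifP => wm; rewrite ?mulr0 //.
by rewrite Ef ?mulr0 //; apply: contra Em => /(upE _ w); rewrite submK.
Qed.

Lemma midealX E m : mideal E 'X_[m] <-> E m.
Proof.
split=> [H|Em c]; last by rewrite mcoeffX; case: eqP => // <-; rewrite Em.
by apply/negPn/negP => /H/eqP; rewrite mcoeffX eqxx oner_eq0.
Qed.

Lemma mideal_colon E w f :
  upclosed E -> mideal E ('X_[w] * f) <-> mideal (fun m => E (w + m)%MM) f.
Proof.
move=> upE; split=> H m Em; first by rewrite -(mcoeffXMD w) H.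
rewrite mcoeffXM; case: ifP => // wm; apply: H.
by rewrite addmC submK.
Qed.

Definition mproj E f : S := \sum_(m <- msupp f | E m) f@_m *: 'X_[m].

Lemma mcoeff_mproj E f m : (mproj E f)@_m = if E m then f@_m else 0.
Proof.
rewrite /mproj raddf_sum /=.
transitivity (\sum_(c <- msupp f | E c && (c == m)) f@_c).
  rewrite [LHS]big_mkcond [RHS]big_mkcond; apply: eq_bigr => c _.
  by rewrite mcoeffZ mcoeffX; case: (E c) => //=; case: eqP => _; rewrite ?mulr1 ?mulr0.
case: ifP => Em; last by rewrite big1 // => c /andP[Ec /eqP cm]; rewrite -cm Ec in Em.
rewrite (eq_bigl (pred1 m)) => [|c /=]; last by case: eqP => [->|]; rewrite ?Em ?andbF.
have [mf|mf] := boolP (m \in msupp f).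
  by rewrite -big_filter filter_pred1_uniq ?msupp_uniq // big_seq1.
rewrite (memN_msupp_eq0 mf) big_seq_cond big1 // => c /andP[cf /eqP cm].
by rewrite -cm cf in mf.
Qed.

Lemma mideal_addX E w : upclosed E ->
  ideal_add (mideal E) [:: 'X_[w]] = mideal (fun m => E m || (w <= m)%MM).
Proof.
move=> upE; apply: predeqP => f; split.
  case/(ideal_add1P _ _ (mideal_ideal upE)) => g Eg m; rewrite negb_or => /andP[Em /negbTE wm].
  by rewrite -[f](subrK ('X_[w] * g)) mcoeffD Eg // mcoeffXM wm addr0.
move=> Ef; case: (ideal_add_ideal (mideal E) [:: 'X_[w]]) => I0 ID IM.
rewrite (mpolyE f); apply: ideal_sum => // m _; rewrite -mul_mpolyC.
have [Em|Em] := boolP (E m); first by apply/IM/ideal_addW/midealX.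
have [wm|wm] := boolP (w <= m)%MM; last first.
  by rewrite Ef ?negb_or ?Em // mpolyC0 mul0r.
by rewrite -(submK wm) mpolyXD mulrA; apply/IM/ideal_add_mem/mem_head.
Qed.

Definition face_prime A : S -> Prop := mideal (fun m => 0 < wt A m)%N.

Lemma upclosed_wt A l : upclosed (fun m => l <= wt A m)%N.
Proof. by move=> m c H; rewrite wtD; apply: leq_trans H (leq_addr _ _). Qed.

Lemma upclosed_or E w : upclosed E -> upclosed (fun m => E m || (w <= m)%MM).
Proof.
move=> upE m c /orP[/(upE _ c)->//|wm].
by rewrite (lepm_trans wm (lem_addr _ _)) orbT.
Qed.

Lemma mideal_colon_prime E A w f : upclosed E ->
  (forall j, j \notin A -> E (w + U_(j))%MM) ->
  (forall c, wt A c = 0%N -> ~~ E (w + c)%MM) ->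
  face_prime A f <-> mideal E ('X_[w] * f).
Proof.
move=> upE Ew NEw; rewrite mideal_colon //; rewrite (@eq_mideal _ (fun m => 0 < wt A m)%N) // => m.
have [/wt_gt0P[i iA mi]|] := boolP (0 < wt A m)%N.
  by rewrite (subm1K mi) addmA upE ?Ew.
by rewrite -eqn0Ngt => /eqP/NEw/negbTE.
Qed.

(* The filtration of S/(E) whose successive quotients are the shifts by w of
   S/face_prime A, for (w, A) running through W. *)
Fixpoint clean_filtration E (W : seq (mnm * {set 'I_n})) : Prop :=
  if W is (w, A) :: W' then
    [/\ forall j, j \notin A -> E (w + U_(j))%MM,
        forall c, wt A c = 0%N -> ~~ E (w + c)%MM
      & clean_filtration (fun m => E m || (w <= m)%MM) W']
  else forall m, E m.

Lemma weakly_regular_whole J s : (forall f : S, J f) -> weakly_regular J s.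
Proof. by elim: s J => //= t s IH J HJ; split=> //; apply: IH => f; apply: ideal_addW. Qed.

Lemma clean_filtration_regular E W s : upclosed E -> clean_filtration E W ->
  (forall x, x \in W -> weakly_regular (face_prime x.2) s) ->
  weakly_regular (mideal E) s.
Proof.
elim: W E => [|[w A] W IH] E upE /=.
  by move=> allE _; apply: weakly_regular_whole => f m; rewrite allE.
case=> Ew NEw clW reg.
apply: (@weakly_regular_extension _ _ _ _ (face_prime A) 'X_[w] s
  (mideal_ideal upE) (mideal_ideal (@upclosed_wt A 1)) (esym (mideal_addX w upE))).
- by move=> f; apply: mideal_colon_prime.
- by apply: reg (mem_head _ _).
- apply: IH => //; first exact: upclosed_or.
  by move=> x xW; apply: reg; rewrite inE xW orbT.
Qed.

(** Since E ignores the exponents on A, its complement consists of finitely many exponents supported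
    off A, plus arbitrary exponents on A. Adding to the ideal one of the former of largest degree
    costs a single copy of S/P_A and leaves fewer of them. *)
Lemma coprimary_clean_filtration E A D : upclosed E ->
  (forall m c, wt A c = 0%N -> E (m + c)%MM = E m) ->
  (forall m, (D <= wt A m)%N -> E m) ->
  exists2 W, clean_filtration E W & forall x, x \in W -> x.2 = A.
Proof.
pose off m := [forall i in A, m i == 0%N].
have off_wt m : off m -> mdeg m = wt A m.
  move=> /forall_inP om; rewrite mdegE (bigID (fun i => i \in A)) /= big1 // => i iA.
  exact/eqP/om.
pose std E := [pred b : 'X_{1..n < D} | ~~ E (bmnm b) && off (bmnm b)].
have [N leN] := ubnP #|std E|; elim: N E leN => // N IH E leN upE invE ED.
case: (pickP (std E)) => [b0 stdb0|nstd]; last first.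
  exists [::] => // m; apply/negPn/negP => Em.
  pose m0 := [multinom if i \in A then 0%N else m i | i < n].
  pose m1 := [multinom if i \in A then m i else 0%N | i < n].
  have m1A : wt A m1 = 0%N.
    by apply/eqP/wt_eq0P => i /negbTE iA; rewrite mnmE iA.
  have Em0 : ~~ E m0.
    rewrite -(invE m0 m1) //; suff -> : (m0 + m1)%MM = m by [].
    by apply/mnmP => i; rewrite mnmDE !mnmE; case: ifP; rewrite ?addn0.
  have om0 : off m0 by apply/forall_inP => i iA; rewrite mnmE iA.
  have dm0 : (mdeg m0 < D)%N by rewrite off_wt // ltnNge; apply: contra Em0 => /ED.
  by have := nstd (BMultinom dm0); rewrite /= Em0 om0.
case: (arg_maxnP (fun b : 'X_{1..n < D} => mdeg (bmnm b)) stdb0) => b /andP[Eb ob] bmax.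
set w := bmnm b in Eb ob bmax.
have [||||W clW WA] := IH (fun m => E m || (w <= m)%MM).
- rewrite ltnS in leN; apply: leq_trans leN; apply: proper_card; apply/properP; split.
    by apply/subsetP => c; rewrite !inE negb_or => /andP[/andP[-> _] ->].
  by exists b; rewrite !inE ?Eb ?ob // lepm_refl orbT.
- exact: upclosed_or.
- move=> m c Ac; rewrite invE //; congr (_ || _).
  apply/mnm_lepP/mnm_lepP => H i; have := H i; rewrite mnmDE.
    have [iA|iA] := boolP (i \in A); first by rewrite (eqP (forall_inP ob i iA)).
    by rewrite (wt_eq0P A c _ i iA) ?Ac // addn0.
  by move=> wi; apply: leq_trans wi (leq_addr _ _).
- by move=> m /ED ->.
exists ((w, A) :: W) => [|x]; last by rewrite inE => /orP[/eqP->|/WA].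
split=> // [j jA|c Ac]; last by rewrite invE.
apply/negPn/negP => Ewj.
have owj : off (w + U_(j))%MM.
  apply/forall_inP => i iA; rewrite mnmDE (eqP (forall_inP ob i iA)) mnm1E.
  by case: (j =P i) jA => // ->; rewrite iA.
have dwj : (mdeg (w + U_(j)) < D)%N by rewrite off_wt // ltnNge; apply: contra Ewj => /ED.
have := bmax (BMultinom dwj); rewrite /= Ewj owj => /(_ isT).
by rewrite mdegD mdeg1 addn1 ltnn.
Qed.

Lemma coprimary_regular E A D s : upclosed E ->
  (forall m c, wt A c = 0%N -> E (m + c)%MM = E m) ->
  (forall m, (D <= wt A m)%N -> E m) ->
  weakly_regular (face_prime A) s -> weakly_regular (mideal E) s.
Proof.
move=> upE invE ED reg; have [W clW WA] := coprimary_clean_filtration upE invE ED.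
by apply: clean_filtration_regular clW _ => // x /WA ->.
Qed.

End MonomialIdeals.

(** * Face ideals and symbolic powers *)

Section FaceIdeals.
Variables (k : fieldType) (n : nat).
Local Notation S := {mpoly k[n]}.
Local Notation mnm := 'X_{1..n}.
Implicit Types (A F : {set 'I_n}) (f g : S) (m : mnm) (J P : S -> Prop) (lq : n.-tuple S).

(** This serves to identify kernels of substitutions: an f that vanishes under [lq] lies in J. *)
Lemma comp_mpoly_congr J (lq : n.-tuple S) f : is_ideal J ->
  (forall i, J ('X_i - tnth lq i)) -> J (f - (f \mPo lq)).
Proof.
move=> idJ Jlq; case: (idJ) => J0 JD JM.
rewrite comp_mpolyEX {1}(mpolyE f) -sumrB; apply: (ideal_sum _ idJ) => m _.
rewrite -scalerBr -mul_mpolyC; apply: (JM); rewrite comp_mpolyX mpolyXE_id.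
pose J' (x y : S) := J (x - y).
have mulJ x y x' y' : J' x y -> J' x' y' -> J' (x * x') (y * y').
  move=> xy xy'; rewrite /J' (_ : _ - _ = x' * (x - y) + y * (x' - y')); last by ring.
  by apply: JD; apply: JM.
apply: (big_ind2 J'); rewrite /J' ?subrr // => i _.
elim: (m i) => [|e IH]; first by rewrite subrr.
by rewrite !exprS; apply: mulJ => //; apply: Jlq.
Qed.

Lemma kernel_prime (lq : n.-tuple S) : is_prime (fun f => f \mPo lq = 0).
Proof.
split=> [||f g /eqP].
- split=> [|f g f0 g0|a f f0]; first exact: comp_mpoly0.
    by rewrite comp_mpolyD f0 g0 addr0.
  by rewrite rmorphM /= f0 mulr0.
- by rewrite comp_mpoly1 => /eqP; rewrite oner_eq0.
- by rewrite rmorphM /= mulf_eq0 => /orP[] /eqP; [left|right].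
Qed.

Definition face_subst A : n.-tuple S := [tuple (if i \in A then 'X_i else 0) | i < n].

Lemma face_prime_ideal A : is_ideal (@face_prime k n A).
Proof. exact/mideal_ideal/upclosed_wt. Qed.

Lemma face_primeX A i : face_prime A ('X_i : S) <-> i \notin A.
Proof. by rewrite /face_prime midealX wtU; case: (i \notin A). Qed.

Lemma face_prime_comp A lq f :
  (forall i, i \notin A -> tnth lq i = 0) -> face_prime A f -> f \mPo lq = 0.
Proof.
move=> lq0 Af; rewrite comp_mpolyEX big1 // => m _.
have [mA|/Af ->] := boolP (0 < wt A m)%N; last by rewrite scale0r.
case/wt_gt0P: mA => i iA mi; rewrite comp_mpolyX (bigD1 i) //= lq0 //.
by rewrite expr0n -(prednK mi) /= mul0r scaler0.
Qed.

(** As the kernel of a map into a domain, the ideal is prime. *)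
Lemma face_primeE A f : face_prime A f <-> f \mPo (face_subst A) = 0.
Proof.
have idA := face_prime_ideal A; split=> [|f0].
  by apply: face_prime_comp => i /negbTE iA; rewrite tnth_mktuple iA.
rewrite -[f]subr0 -f0; apply: (comp_mpoly_congr (J := @face_prime k n A)) => // i; rewrite tnth_mktuple.
case: ifP => iA; first by rewrite subrr; case: idA.
by rewrite subr0; apply/face_primeX; rewrite iA.
Qed.

Lemma face_prime_prime A : is_prime (@face_prime k n A).
Proof. by rewrite (predeqP (face_primeE A)); apply: kernel_prime. Qed.

Lemma nonzerodivisor_prime P f : is_prime P -> ~ P f -> nonzerodivisor P f.
Proof. by case=> _ _ PM Nf g /PM[]. Qed.

(** A monomial of degree at least l off A is a multiple of a product of l variables off A.
    Conversely, degrees off A add up in a product of l elements of P_A. *)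
Lemma face_prime_pow A l :
  ideal_pow (@face_prime k n A) l = mideal (fun m => l <= wt A m)%N.
Proof.
have idE := mideal_ideal k (@upclosed_wt n A l).
apply: predeqP => f; split.
  apply: (ideal_span_min idE) => _ [g [gA ->]].
  elim: l g gA {idE} => [|l IH] g gA; first by rewrite big_ord0.
  rewrite big_ord_recl /= mulrC => m; rewrite -ltnNge => Am.
  rewrite mcoeffM big1 // => -[m1 m2] /= /eqP mE.
  have [m2A|m2A] := boolP (0 < wt A m2)%N; last by rewrite (gA ord0) ?mulr0.
  rewrite (IH (fun i => g (lift ord0 i))) ?mul0r // -ltnNge.
  move: (congr1 (wt A) mE) Am m2A; rewrite wtD; lia.
move=> Af; rewrite (mpolyE f); apply: ideal_sum => [|m _]; first exact: ideal_span_ideal.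
have [mA|/Af->] := boolP (l <= wt A m)%N; last first.
  by rewrite scale0r; case: (ideal_span_ideal (fun f => exists g : 'I_l -> S,
    (forall i, face_prime A (g i)) /\ f = \prod_(i < l) g i)).
have [a [g [gA ->]]] : exists a (g : 'I_l -> S),
    (forall i, face_prime A (g i)) /\ 'X_[m] = a * \prod_(i < l) g i.
  elim: l m mA {f Af idE} => [|l IH] m mA.
    by exists 'X_[m], (fun=> 0); split=> [[]//|]; rewrite big_ord0 mulr1.
  have /wt_gt0P[i iA mi] : (0 < wt A m)%N by apply: leq_trans mA.
  have := mA; rewrite (subm1K mi) wtD wtU iA => /IH [a [g [gA mE]]].
  exists a, (fun j => if unlift ord0 j is Some j' then g j' else 'X_i).
  split=> [j|].
    by case: unliftP => [j' _|_]; [apply: gA | apply/face_primeX].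
  rewrite big_ord_recl unlift_none mpolyXD mE mulrCA; congr (_ * (_ * _)).
  by apply: eq_bigr => j _; rewrite liftK.
rewrite -mul_mpolyC; case: (ideal_span_ideal (fun f => exists g : 'I_l -> S,
    (forall i, face_prime A (g i)) /\ f = \prod_(i < l) g i)) => _ _ IM.
by do 2 apply: (IM); apply: ideal_span_gen; exists g.
Qed.

Definition symbolic_exponent (Delta : {set {set 'I_n}}) l : pred mnm :=
  fun m => [forall F in facets Delta, l <= wt F m]%N.

Lemma upclosed_symbolic Delta l : upclosed (symbolic_exponent Delta l).
Proof.
move=> m c /forall_inP H; apply/forall_inP => F /H; exact: upclosed_wt.
Qed.

Lemma mideal_symbolic Delta l f :
  mideal (symbolic_exponent Delta l) f <->
  forall F, F \in facets Delta -> mideal (fun m => l <= wt F m)%N f.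
Proof.
split=> [Df F FD m Fm|Df m].
  by apply: Df; apply: contra Fm => /forall_inP; apply.
by rewrite negb_forall => /existsP[F]; rewrite negb_imply => /andP[FD]; apply: Df.
Qed.

Lemma facet_containing (Delta : {set {set 'I_n}}) A :
  A \in Delta -> exists2 F, F \in facets Delta & A \subset F.
Proof. by case/maxset_exists => F maxF AF; exists F; rewrite // inE. Qed.

Section Symbolic.
Variable Delta : {set {set 'I_n}}.
Hypothesis cplx : simplicial_complex Delta.

Lemma facet_face F : F \in facets Delta -> F \in Delta.
Proof. by rewrite inE => /maxsetP[]. Qed.

(** The support of m leaves every facet exactly when it is a non-face; it then contains a minimal
    non-face, whose monomial divides X^m. *)
Lemma Stanley_ReisnerE :
  Stanley_Reisner k Delta = mideal (symbolic_exponent Delta 1).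
Proof.
case: (cplx) => _ down _; have idE := mideal_ideal k (@upclosed_symbolic Delta 1).
have monoE A : monomial_of k A = 'X_[mesym1 A].
  rewrite /monomial_of mprodXE; congr 'X_[_]; apply/mnmP => i.
  rewrite mnm_sumE mnmE; case: (boolP (i \in A)) => iA.
    by rewrite (bigD1 i) //= mnm1E eqxx big1 // => j /andP[_ /negbTE]; rewrite mnm1E => ->.
  by rewrite big1 // => j jA; rewrite mnm1E; case: eqP iA => // <-; rewrite jA.
apply: predeqP => f; split.
  apply: (ideal_span_min idE) => _ [A [minA ->]].
  rewrite monoE; apply/midealX/forall_inP => F /facet_face FD.
  apply/wt_gt0P; case/minsetP: minA => NA _.
  case: (pickP [pred i in A | i \notin F]) => [i /andP[iA iF]|AF].
    by exists i; rewrite // mnmE iA.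
  case/negP: NA; apply: down FD _; apply/subsetP => i iA.
  by have := AF i; rewrite /= iA => /negbFE.
move=> Ef; rewrite (mpolyE f); apply: ideal_sum => [|m _]; first exact: ideal_span_ideal.
have [I0 _ IM] := ideal_span_ideal (fun f : S => exists A : {set 'I_n},
  minset (fun B => B \notin Delta) A /\ f = monomial_of k A).
have [Em|/Ef->] := boolP (symbolic_exponent Delta 1 m); last by rewrite scale0r.
have : [set i | (0 < m i)%N] \notin Delta.
  apply/negP => /facet_containing [F FD /subsetP mF].
  have /wt_gt0P[i iF mi] := forall_inP Em F FD.
  by have := mF i; rewrite inE mi (negbTE iF) => /(_ isT).
case/(minset_exists (P := fun B => B \notin Delta)) => A minA /subsetP Am.
have le_Am : (mesym1 A <= m)%MM.
  apply/mnm_lepP => i; rewrite mnmE; case: (boolP (i \in A)) => // /Am.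
  by rewrite inE.
rewrite -(submK le_Am) mpolyXD scalerAl; apply: IM; apply: ideal_span_gen.
by exists A.
Qed.

(** P_F is the colon of the ideal by the product of the variables in F, since no other facet
    contains F. Conversely, for P the colon by f, one looks for a facet F with f outside P_F and all
    variables off F in P: the former gives P inside P_F, the latter the other inclusion. *)
Lemma associated_primeE P :
  associated_prime (Stanley_Reisner k Delta) P <->
  exists2 F, F \in facets Delta & P = @face_prime k n F.
Proof.
rewrite Stanley_ReisnerE; split=> [[primeP [f Pf]]|[F FD ->]]; last first.
  split; first exact: face_prime_prime.
  exists 'X_[mesym1 F] => g; rewrite mulrC mideal_symbolic.
  have colon G : mideal (fun m => 0 < wt G m)%N ('X_[mesym1 F] * g) <->
      mideal (fun m => 0 < wt G (mesym1 F + m))%N g.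
    by apply: mideal_colon; apply: upclosed_wt.
  split=> [Fg G GD|/(_ F FD)/colon Fg m Fm]; last first.
    apply: Fg; rewrite wtD (_ : wt F _ = 0%N) //.
    by apply/eqP/wt_eq0P => i /negbTE iF; rewrite mnmE iF.
  apply/colon => m; rewrite wtD addn_gt0 negb_or => /andP[/wt_gt0P Gm mG].
  apply: Fg; have -> : F = G; last by [].
  apply/eqP; rewrite eqEsubset; have FG : F \subset G.
    apply/subsetP => i iF; apply/negPn/negP => iG; apply: Gm; exists i => //.
    by rewrite mnmE iF.
  rewrite FG; move: FD GD; rewrite !inE => /maxsetP[_ maxF] /maxsetP[GD _].
  by rewrite (maxF G GD FG) subxx.
have [idP P1 PM] := primeP.
have PF F : F \in facets Delta -> ~ face_prime F f -> forall g, P g -> face_prime F g.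
  move=> FD Ff g /Pf; rewrite mideal_symbolic => /(_ F FD).
  by have [_ _ FM] := face_prime_prime F; case/FM.
have [[F FD [Ff FP]]|noF] := classic (exists2 F, F \in facets Delta &
    ~ @face_prime k n F f /\ forall i, i \notin F -> P 'X_i).
  exists F => //; apply: predeqP => g; split; first exact: PF.
  move=> /face_primeE g0; rewrite -[g]subr0 -g0.
  apply: comp_mpoly_congr => // i; rewrite tnth_mktuple; case: ifP => iF.
    by rewrite subrr; case: idP.
  by rewrite subr0; apply: FP; rewrite iF.
(* If there is no such facet, each facet F has some h outside P such that P_F contains f or h. Then
   f times the product of all these h lies in every P_F, so the product lies in P, against
   primality. *)
have avoid F : F \in facets Delta ->
    exists h, ~ P h /\ (face_prime F f \/ face_prime F h).
  move=> FD; have [Ff|Ff] := classic (face_prime F f); first by exists 1; split; [|left].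
  have [i Fi] : exists i, i \notin F /\ ~ P 'X_i.
    apply: NNPP => H; apply: noF; exists F => //; split=> // i iF.
    by apply: NNPP => Pi; apply: H; exists i.
  by exists 'X_i; split; [case: Fi | right; apply/face_primeX; case: Fi].
have [h hP] : exists h : {set 'I_n} -> S, forall F, F \in facets Delta ->
    ~ P (h F) /\ (face_prime F f \/ face_prime F (h F)).
  apply: (fin_all_exists (P := fun F h => F \in facets Delta ->
    ~ P h /\ (face_prime F f \/ face_prime F h))) => F.
  by have [/avoid[h Hh]|FD] := boolP (F \in facets Delta); [exists h | exists 0].
have : P (\prod_(F in facets Delta) h F).
  apply/Pf/mideal_symbolic => F FD; have [_ _ FM] := face_prime_ideal F.
  have [_ []] := hP F FD; first exact: FM.
  by move=> Fh; rewrite (bigD1 F) //= mulrAC -mulrA mulrC -mulrA; do 2 apply: (FM).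
by case/(prime_ideal_prod primeP) => F FD PhF; case: (hP F FD).
Qed.

Lemma symbolic_powerE l :
  symbolic_power (Stanley_Reisner k Delta) l = mideal (symbolic_exponent Delta l).
Proof.
apply: predeqP => f; rewrite mideal_symbolic; split=> [Hf F FD|Hf P].
  by rewrite -face_prime_pow; apply: Hf; apply/associated_primeE; exists F.
by case/associated_primeE => F FD ->; rewrite face_prime_pow; apply: Hf.
Qed.

End Symbolic.
End FaceIdeals.

(** * Bounding depth and dimension *)

Section Growth.
Variables (k : fieldType) (n : nat).
Local Notation S := {mpoly k[n]}.
Local Notation mnm := 'X_{1..n}.
Implicit Types (J : S -> Prop) (s : seq S).

(* The common feature of regular sequences and of elements chosen along a
   chain of primes: either is algebraically independent modulo J. *)
Fixpoint regular_chain J s : Prop :=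
  if s is t :: s' then
    nonzerodivisor J t /\
    exists J', [/\ is_ideal J', forall f, J f -> J' f, J' t & regular_chain J' s']
  else ~ J 1.

Lemma weakly_regular_chain J s :
  weakly_regular J s -> ~ ideal_add J s 1 -> regular_chain J s.
Proof.
elim: s J => /= [J _ H /(ideal_addW [::])//|t s IH J [regt regs] N1].
split=> //; exists (ideal_add J [:: t]); split; first exact: ideal_add_ideal.
- by move=> f; apply: ideal_addW.
- by apply: ideal_add_mem; rewrite mem_head.
- by apply: IH => //; rewrite -ideal_add_cons.
Qed.

(** Each element is chosen in one prime and outside the preceding one, modulo which it is therefore
    regular. *)
Lemma prime_chain_regular (P : nat -> S -> Prop) l :
  (forall i, (i <= l)%N -> is_prime (P i)) ->
  (forall i, (i < l)%N ->
    (forall f, P i f -> P i.+1 f) /\ exists f, P i.+1 f /\ ~ P i f) ->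
  exists2 s, regular_chain (P 0%N) s & size s = l.
Proof.
elim: l P => [|l IH] P primeP incP; first by exists [::] => //=; case: (primeP 0%N).
have [s chs sz] := IH (fun i => P i.+1) (fun i => primeP i.+1) (fun i => incP i.+1).
have [P01 [f [P1f P0f]]] := incP 0%N erefl.
exists (f :: s) => /=; last by rewrite sz.
split; first exact: nonzerodivisor_prime (primeP 0%N _) P0f.
by exists (P 1%N); split=> //; case: (primeP 1%N).
Qed.

(** The first element t is regular, so the relation may be divided by the smallest power of t that
    occurs. Modulo J', which contains t, only the terms with this smallest exponent survive, and
    they form a relation between the remaining elements. *)
Lemma regular_chain_independent J s (I : finType) (A : {set I}) (c : I -> k)
    (e : I -> nat -> nat) :
  is_ideal J -> regular_chain J s ->
  {in A &, forall i i', (forall j, (j < size s)%N -> e i j = e i' j) -> i = i'} ->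
  J (\sum_(i in A) c i *: \prod_(j < size s) s`_j ^+ e i j) ->
  {in A, forall i, c i != 0} -> A = set0.
Proof.
elim: s J A e => [|t s IH] J A e idJ.
  move=> N1 inje JA c0; apply/eqP; apply/set0Pn => -[i0 i0A]; apply: N1.
  have AE : A = [set i0].
    by apply/setP => i; rewrite inE; apply/idP/eqP => [iA|->//]; apply: inje.
  move: JA; rewrite AE big_set1 big_ord0 => Jc; case: idJ => _ _ JM.
  have -> : 1 = (c i0)^-1%:MP * (c i0 *: 1) :> S.
    by rewrite mul_mpolyC scalerA mulVf ?scale1r // c0.
  exact: JM.
case=> regt [J' [idJ' JJ' J't chs]] inje JA c0.
apply/eqP/set0Pn => -[i0 i0A]; case: (idJ') => _ J'D J'M.
case: (arg_minnP (fun i => e i 0%N) i0A) => i1 i1A mine.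
move: i1A => /= i1A; set e0 := e i1 0%N in mine.
pose g i : S := c i *: \prod_(j < size s) s`_j ^+ e i j.+1.
have J'g : J' (\sum_(i in A) t ^+ (e i 0%N - e0) * g i).
  apply: JJ'; have : J (t ^+ e0 * \sum_(i in A) t ^+ (e i 0%N - e0) * g i).
    rewrite mulr_sumr; congr J: JA; apply: eq_bigr => i /mine ei.
    by rewrite mulrA -exprD subnKC // big_ord_recl /= -scalerAr.
  move: (\sum_(i in A) _) => y; elim: e0 {mine} => [|e0 IHe]; first by rewrite expr0 mul1r.
  by rewrite exprS -mulrA => /regt/IHe.
pose A' := [set i in A | e i 0%N == e0].
have i1A' : i1 \in A' by rewrite inE eqxx andbT; apply: i1A.
suff A'0 : A' = set0 by rewrite A'0 inE in i1A'.
apply: (IH J' A' (fun i j => e i j.+1)) => //.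
- move=> i i'; rewrite !inE => /andP[iA /eqP ei] /andP[i'A /eqP ei'] eqe.
  by apply: inje => // -[|j] ltj; [rewrite ei ei' | apply: eqe].
- rewrite -[X in J' X](addrK (\sum_(i in A | e i 0%N != e0) t ^+ (e i 0%N - e0) * g i)).
  apply: ideal_sub => //.
    move: J'g; rewrite (bigID (fun i => e i 0%N == e0)) /=; congr (J' (_ + _)).
    apply: eq_big => [i|i /andP[_ /eqP->]]; first by rewrite !inE.
    by rewrite subnn mul1r.
  apply: ideal_sum => // i /andP[iA ei]; rewrite mulrC; apply: (J'M).
  have : (0 < e i 0 - e0)%N by rewrite subn_gt0 ltn_neqAle eq_sym ei mine.
  by case: (_ - _)%N => // m _; rewrite exprSr; apply: J'M.
- by move=> i; rewrite inE => /andP[/c0].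
Qed.

Definition deg_le D : S -> Prop := mideal (fun m => mdeg m <= D)%N.

Lemma deg_leM a b f g : deg_le a f -> deg_le b g -> deg_le (a + b) (f * g).
Proof.
move=> fa gb m; rewrite -ltnNge => mab; rewrite mcoeffM big1 // => -[m1 m2] /= /eqP mE.
have [m1a|m1a] := leqP (mdeg m1) a; last by rewrite fa ?mul0r // -ltnNge.
rewrite [g@_m2]gb ?mulr0 // -ltnNge; move: (congr1 mdeg mE) mab m1a; rewrite mdegD; lia.
Qed.

Lemma deg_le_exp D f e : deg_le D f -> deg_le (e * D) (f ^+ e).
Proof.
move=> fD; elim: e => [|e IH]; last by rewrite exprS mulSn; apply: deg_leM.
move=> m; rewrite -ltnNge expr0 mcoeff1 -mdeg_eq0; by case: (mdeg m).
Qed.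

Lemma deg_le_prod s D t (e : 'I_t -> nat) :
  (forall j, deg_le D s`_j) -> deg_le (\sum_j e j * D) (\prod_(j < t) s`_j ^+ e j).
Proof.
move=> sD; apply: (big_ind2 (fun a f => deg_le a f)).
- by move=> m; rewrite -ltnNge mcoeff1 -mdeg_eq0; case: (mdeg m).
- by move=> a f b g; apply: deg_leM.
- by move=> j _; apply: deg_le_exp.
Qed.

(* The s^a with a in [0, N)^t have degree O(N), hence involve O(N^d) monomials
   outside E; for t > d and large N this is less than N^t. *)
Lemma products_dependent (fs : {set {set 'I_n}}) d l (E : pred mnm) s :
  (forall m, ~~ E m -> exists2 F, F \in fs & (wt F m < l)%N) ->
  (forall F, F \in fs -> (#|F| <= d)%N) -> (d < size s)%N ->
  exists N (c : {ffun 'I_(size s) -> 'I_N} -> k),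
    (exists a, c a != 0) /\
    mideal E (\sum_a c a *: \prod_(j < size s) s`_j ^+ a j).
Proof.
move=> thin size_fs lt_d; set t := size s in lt_d *.
have [D sD] : exists D, forall j, deg_le D s`_j.
  exists (\max_(f <- s) msize f)%N => j m; rewrite -ltnNge => Dm.
  have [ltj|gej] := ltnP j (size s); last by rewrite nth_default ?mcoeff0.
  apply/memN_msupp_eq0/msize_mdeg_ge/ltnW; apply: leq_ltn_trans Dm.
  by apply: (@leq_bigmax_seq _ s xpredT (fun f : S => msize f)); rewrite ?mem_nth.
(* As B + 1 is at most (t D + 1) N, there are at most C N^d codes for the monomials below; N = C + 1
   makes this less than N^(d+1), hence less than N^t. *)
pose C := (#|{: {set 'I_n}}| * ((t * D).+1 ^ d * l.+1 ^ n))%N; pose N := C.+1.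
pose B := (t * N * D)%N; exists N.
pose row := {ffun 'I_t -> 'I_N}.
(* A monomial outside E of degree at most B is coded by a set F, its exponents along the enumeration
   of F, and its exponents off F, which are less than l. *)
pose col := ({set 'I_n} * ({ffun 'I_d -> 'I_B.+1} * {ffun 'I_n -> 'I_l.+1}))%type.
pose mon (a : col) : mnm := [multinom if i \in a.1
  then oapp (fun j => nat_of_ord (a.2.1 j)) 0%N (insub (index i (enum a.1)))
  else nat_of_ord (a.2.2 i) | i < n].
have monP m : ~~ E m -> (mdeg m <= B)%N -> exists a, mon a = m.
  move=> /thin [F FS Fm] mB.
  have miB i : (m i <= B)%N by apply: leq_trans mB; rewrite mdegE (bigD1 i) ?leq_addr.
  exists (F, ([ffun j : 'I_d => inord (nth 0%N [seq m i | i <- enum F] j)],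
              [ffun i => inord (m i)])).
  apply/mnmP => i; rewrite mnmE /=; case: ifP => iF.
    have ltiF : (index i (enum F) < #|F|)%N by rewrite cardE index_mem mem_enum.
    have ltid : (index i (enum F) < d)%N by apply: leq_trans ltiF (size_fs F FS).
    rewrite insubT /= ffunE /= (nth_map i) -?cardE // nth_index ?mem_enum //.
    by rewrite inordK // ltnS.
  rewrite ffunE inordK // ltnW // ltnS; apply: leq_trans Fm.
  by rewrite ltnS /wt (bigD1 i) ?iF //= leq_addr.
have card_lt : (#|{: col}| < #|{: row}|)%N.
  rewrite /col !card_prod /row !card_ffun !card_ord.
  have BN : (B.+1 <= (t * D).+1 * N)%N.
    by rewrite mulSn -mulnA (mulnC D) mulnA addnC -addn1 leq_add2l.
  apply: (@leq_ltn_trans (C * N ^ d)).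
    rewrite /C -mulnA leq_mul2l; apply/orP; right.
    rewrite mulnAC -expnMn leq_mul2r; apply/orP; right.
    by case: (d) => // d'; rewrite leq_exp2r.
  apply: (@leq_trans (N ^ d.+1)); last by rewrite leq_pexp2l.
  by rewrite expnS ltn_pmul2r ?expn_gt0.
(* The coefficients of the products at the coded monomials: with more rows than columns, the rows
   satisfy a linear relation. *)
pose M := \matrix_(i < #|{: row}|, j < #|{: col}|)
  (\prod_(j < t) s`_j ^+ (enum_val i : row) j : S)@_(mon (enum_val j)).
have : kermx M != 0.
  rewrite kermx_eq0 /row_free neq_ltn.
  by rewrite (leq_ltn_trans (rank_leq_col M) card_lt).
case/rowV0Pn => v /sub_kermxP vM v0.
exists (fun a => v 0 (enum_rank a)); split.
  case/rV0Pn: v0 => i vi; by exists (enum_val i); rewrite enum_valK.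
move=> m Em; rewrite raddf_sum /=.
have [mB|Bm] := leqP (mdeg m) B; last first.
  rewrite big1 // => a _; rewrite mcoeffZ (deg_le_prod sD) ?mulr0 // -ltnNge.
  apply: leq_ltn_trans Bm; rewrite /B.
  apply: (@leq_trans (\sum_(j < t) N * D)%N).
    by apply: leq_sum => j _; rewrite leq_mul2r ltnW ?orbT.
  by rewrite sum_nat_const card_ord mulnA.
have [a aE] := monP m Em mB.
have := congr1 (fun w : 'rV_ _ => w 0 (enum_rank a)) vM.
rewrite !mxE => {2}<-; rewrite (reindex (@enum_val _ [pred _ : row | true])) /=; last first.
  by apply: onW_bij; apply: enum_val_bij.
by apply: eq_bigr => i _; rewrite mcoeffZ enum_valK mxE enum_rankK aE.
Qed.

Theorem regular_chain_size J (fs : {set {set 'I_n}}) d l (E : pred mnm) s :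
  is_ideal J -> (forall f, mideal E f -> J f) ->
  (forall m, ~~ E m -> exists2 F, F \in fs & (wt F m < l)%N) ->
  (forall F, F \in fs -> (#|F| <= d)%N) ->
  regular_chain J s -> (size s <= d)%N.
Proof.
move=> idJ EJ thin size_fs chs; rewrite leqNgt; apply/negP => lt_d.
have [N [c [[a ca] /EJ Jc]]] := products_dependent thin size_fs lt_d.
pose e (b : {ffun 'I_(size s) -> 'I_N}) j := oapp (fun j' => nat_of_ord (b j')) 0%N (insub j).
have eE b (j : 'I_(size s)) : e b j = b j by rewrite /e valK.
have : [set b | c b != 0] = set0.
  apply: (@regular_chain_independent _ s _ _ c e idJ chs).
  - move=> b b' _ _ eqe; apply/ffunP => j; apply/val_inj.
    by have := eqe j (ltn_ord j); rewrite !eE.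
  - move: Jc; rewrite (bigID (fun b => c b != 0)) /= [X in _ + X]big1 ?addr0.
      congr J; apply: eq_big => [b|b _]; first by rewrite inE.
      by congr (_ *: _); apply: eq_bigr => j _; rewrite eE.
    by move=> b /negPn/eqP->; rewrite scale0r.
  - by move=> b; rewrite inE.
by move/setP/(_ a); rewrite !inE ca.
Qed.

End Growth.

(** * Gluing along facets *)

Section Gluing.
Variables (k : fieldType) (n : nat) (Delta : {set {set 'I_n}}) (l : nat).
Local Notation S := {mpoly k[n]}.
Local Notation mnm := 'X_{1..n}.
Implicit Types (A F G H : {set 'I_n}) (f g : S) (m : mnm).

Definition primary F : S -> Prop := mideal (fun m => l <= wt F m)%N.
(** The sum P_F^l + P_H^l, modulo which polynomials given on the two components have to agree. *)
Definition mixed F H : S -> Prop := mideal (fun m => (l <= wt F m) || (l <= wt H m))%N.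
Local Notation J := (mideal (symbolic_exponent Delta l) : S -> Prop).

Lemma primary_ideal F : is_ideal (primary F).
Proof. exact/mideal_ideal/upclosed_wt. Qed.

Lemma upclosed_mixed F H : upclosed (fun m : mnm => (l <= wt F m) || (l <= wt H m))%N.
Proof. by move=> m c /orP[] /upclosed_wt ->; rewrite ?orbT. Qed.

Lemma mixed_ideal F H : is_ideal (mixed F H).
Proof. exact/mideal_ideal/upclosed_mixed. Qed.

Lemma primary_mixedl F H f : primary F f -> mixed F H f.
Proof. by move=> Ff m; rewrite negb_or => /andP[/Ff]. Qed.

Lemma primary_mixedr F H f : primary H f -> mixed F H f.
Proof. by move=> Hf m; rewrite negb_or => /andP[_ /Hf]. Qed.

Lemma wt_subset F G m : F \subset G -> (wt G m <= wt F m)%N.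
Proof.
move=> FG; rewrite /wt [X in (_ <= X)%N](bigID (fun i => i \notin G)) /=.
apply: leq_trans (leq_addr _ _); rewrite leq_eqVlt; apply/orP; left; apply/eqP.
apply: eq_bigl => i; case: (boolP (i \in G)) => iG; rewrite ?andbF // andbT.
by apply/esym; apply: contra iG => /(subsetP FG).
Qed.

Lemma face_prime_subset F G f : F \subset G -> face_prime G f -> face_prime F f.
Proof.
move=> FG Gf m mF; apply: Gf; apply: contra mF => /leq_trans; apply.
exact: wt_subset.
Qed.

Lemma wt_setI F H m : (wt (F :&: H) m <= wt F m + wt H m)%N.
Proof.
rewrite /wt ![(\sum_(i | _) _)%N]big_mkcond /= -big_split; apply: leq_sum => i _.
by rewrite in_setI negb_and; case: (i \in F); case: (i \in H); rewrite /= ?leq_addr.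
Qed.

(** The ideal is coprimary: membership ignores the exponents on the intersection of F and H, and
    degree 2l off that intersection forces degree l off F or off H. *)
Lemma mixed_regular F H s :
  weakly_regular (@face_prime k n (F :&: H)) s -> weakly_regular (mixed F H) s.
Proof.
apply: (@coprimary_regular _ _ _ _ (l + l)); first exact: upclosed_mixed.
  move=> m c c0; suff [Fc Hc] : wt F c = 0%N /\ wt H c = 0%N by rewrite !wtD Fc Hc !addn0.
  by split; apply/eqP; rewrite -leqn0 -c0 wt_subset ?subsetIl ?subsetIr.
move=> m lm; have := leq_trans lm (wt_setI F H m); case: (leqP l (wt F m)) => //=; lia.
Qed.

Lemma primary_mixed F : primary F = mixed F F.
Proof. by apply: eq_mideal => m; rewrite orbb. Qed.

Lemma primary_regular F s :
  weakly_regular (@face_prime k n F) s -> weakly_regular (primary F) s.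
Proof. by rewrite primary_mixed => reg; apply: mixed_regular; rewrite setIid. Qed.

Lemma mixed_nonzerodivisor F H f :
  ~ face_prime (F :&: H) f -> nonzerodivisor (mixed F H) f.
Proof.
move=> Ff; have [] // : weakly_regular (mixed F H) [:: f].
by apply: mixed_regular; split=> //; apply: nonzerodivisor_prime Ff; apply: face_prime_prime.
Qed.

Lemma primary_nonzerodivisor F f : ~ face_prime F f -> nonzerodivisor (primary F) f.
Proof. by rewrite primary_mixed => Ff; apply: mixed_nonzerodivisor; rewrite setIid. Qed.

Lemma symbolic_ideal : is_ideal J.
Proof. exact/mideal_ideal/upclosed_symbolic. Qed.

Lemma symbolicP f : J f <-> forall F, F \in facets Delta -> primary F f.
Proof. exact: mideal_symbolic. Qed.

Lemma symbolic_nonzerodivisor f :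
  (forall F, F \in facets Delta -> ~ face_prime F f) -> nonzerodivisor J f.
Proof.
move=> Ff g /symbolicP Jfg; apply/symbolicP => F FD.
exact: (primary_nonzerodivisor (Ff F FD)) (Jfg F FD).
Qed.

(* Any two facets of the degree complex of the l-th symbolic power at m, whose
   facets F are given by wt F m < l, meet a common third one. *)
Definition linked : Prop := forall m F G,
  F \in facets Delta -> G \in facets Delta -> (wt F m < l)%N -> (wt G m < l)%N ->
  exists H, [/\ H \in facets Delta, (wt H m < l)%N, F :&: H != set0 & H :&: G != set0].

(** The coefficient of g at X^m is taken from one chosen facet of the degree complex at m. Passing
    through a common neighbour shows that every other facet there has the same coefficient. *)
Lemma glue (s : {set 'I_n} -> S) : linked ->
  (forall F H, F \in facets Delta -> H \in facets Delta -> F :&: H != set0 ->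
    mixed F H (s F - s H)) ->
  exists g, forall F, F \in facets Delta -> primary F (g - s F).
Proof.
move=> lk compat.
have agree F H m : F \in facets Delta -> H \in facets Delta -> F :&: H != set0 ->
    (wt F m < l)%N -> (wt H m < l)%N -> (s F)@_m = (s H)@_m.
  move=> FD HD FH Fm Hm; apply/eqP; rewrite -subr_eq0 -mcoeffB; apply/eqP.
  by apply: compat FH _ _ => //; rewrite negb_or -!ltnNge Fm.
pose std m := [pick F in facets Delta | wt F m < l]%N.
exists (\sum_(F in facets Delta) mproj (fun m => std m == Some F) (s F)) => F FD m.
rewrite -ltnNge => Fm; rewrite mcoeffB raddf_sum /=; apply/eqP; rewrite subr_eq0; apply/eqP.
have [G [GD Gm stdm]] : exists G, [/\ G \in facets Delta, (wt G m < l)%N & std m = Some G].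
  rewrite /std; case: pickP => [G /andP[GD Gm]|/(_ F)]; first by exists G.
  by rewrite FD Fm.
rewrite (bigD1 G) //= mcoeff_mproj stdm eqxx big1 ?addr0; last first.
  by move=> H /andP[_ HG]; rewrite mcoeff_mproj stdm eqE /= eq_sym (negbTE HG).
have [H [HD Hm GH HF]] := lk m G F GD FD Gm Fm.
by rewrite (agree G H) // (agree H F).
Qed.

(* If v g = u h modulo the symbolic power J, then g = u s_F modulo each primary
   component of J, and the s_F glue because u is a nonzerodivisor modulo the sum
   of two components whose facets meet. *)
Lemma linked_weakly_regular u v : linked ->
  (forall i, ~ face_prime [set i] u) ->
  (forall F, F \in facets Delta -> F != set0 /\ weakly_regular (@face_prime k n F) [:: u; v]) ->
  weakly_regular J [:: u; v].
Proof.
move=> lk u_i reg.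
have u_A A : A != set0 -> ~ face_prime A u.
  by case/set0Pn => i iA Au; apply: (u_i i); apply: face_prime_subset Au; rewrite sub1set.
split; first by apply: symbolic_nonzerodivisor => F /reg[F0 _]; apply: u_A.
split=> // g; rewrite (ideal_add1P _ _ symbolic_ideal) => -[h Jh].
have [s sP] : exists s : {set 'I_n} -> S, forall F, F \in facets Delta ->
    primary F (g - u * s F).
  apply: (fin_all_exists (P := fun F s => F \in facets Delta -> primary F (g - u * s))) => F.
  have [FD|_] := boolP (F \in facets Delta); last by exists 0.
  have [_ regF] := reg F FD; have [_ [regv _]] := primary_regular regF.
  have /(ideal_add1P _ _ (primary_ideal F)) [s sg] : ideal_add (primary F) [:: u] g.
    apply: regv; apply/(ideal_add1P _ _ (primary_ideal F)); exists h.
    by move/symbolicP: Jh; apply.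
  by exists s.
have [||t tP] := @glue s => //.
  move=> F H FD HD FH; apply: (mixed_nonzerodivisor (u_A _ FH)).
  have -> : u * (s F - s H) = (g - u * s H) - (g - u * s F) by ring.
  apply: (ideal_sub (mixed_ideal F H)).
    exact/primary_mixedr/sP.
  exact/primary_mixedl/sP.
apply/(ideal_add1P _ _ symbolic_ideal); exists t; apply/symbolicP => F FD.
have -> : g - u * t = (g - u * s F) - u * (t - s F) by ring.
case: (primary_ideal F) => _ _ FM.
by apply: (ideal_sub (primary_ideal F)); [apply: sP | apply/FM/tP].
Qed.

End Gluing.

(** * Vanishing of local cohomology *)

Section LocalCohomology.
Variables (k : fieldType) (n : nat).
Local Notation S := {mpoly k[n]}.
Local Notation FracS := {fraction S}.
Local Notation mnm := 'X_{1..n}.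
Implicit Types (J : S -> Prop) (F G H : {set 'I_n}) (f g : S) (c : {ffun {set 'I_n} -> FracS}).

Lemma mpolyX_neq0 (m : mnm) : 'X_[m] != 0 :> S.
Proof. by rewrite -msize_poly_eq0 msizeX. Qed.

Lemma monomial_of1 (i : 'I_n) : monomial_of k [set i] = 'X_i.
Proof. by rewrite /monomial_of big_set1. Qed.

Lemma frac_eq (a b x y : S) : x != 0 -> y != 0 ->
  (tofrac a / tofrac x = tofrac b / tofrac y :> FracS) <-> a * y = b * x.
Proof.
move=> x0 y0; have xF0 : tofrac x != 0 :> FracS by rewrite tofrac_eq0.
have yF0 : tofrac y != 0 :> FracS by rewrite tofrac_eq0.
have E : (tofrac a / tofrac x == tofrac b / tofrac y :> FracS) = (a * y == b * x).
  by rewrite (eqr_div _ _ xF0 yF0) -(@tofrac_eq S (a * y)) (tofracM a) (tofracM b).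
by split=> /eqP; [rewrite E => /eqP | rewrite -E => /eqP].
Qed.

Lemma frac_sub (a b x y : S) : x != 0 -> y != 0 ->
  tofrac a / tofrac x - tofrac b / tofrac y = tofrac (a * y - b * x) / tofrac (x * y) :> FracS.
Proof.
move=> x0 y0; have xF0 : tofrac x != 0 :> FracS by rewrite tofrac_eq0.
have yF0 : tofrac y != 0 :> FracS by rewrite tofrac_eq0.
by rewrite -mulNr (addf_div _ _ xF0 yF0) (tofracM x) tofracB (tofracM a) (tofracM b) mulNr.
Qed.

Lemma cech_diff1 c (i : 'I_n) : cech_diff c [set i] = c set0.
Proof.
rewrite ffunE big_set1 setDv (_ : [set j in [set i] | (j < i)%N] = set0) ?cards0 ?mul1r //.
by apply/setP => j; rewrite !inE; case: eqP => // ->; rewrite ltnn.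
Qed.

Lemma cech_diff2 c (i j : 'I_n) : (i < j)%N ->
  cech_diff c [set i; j] = c [set j] - c [set i].
Proof.
move=> ij; have nij : i \notin [set j] by rewrite inE neq_ltn ij.
rewrite ffunE big_setU1 //= big_set1.
have -> : [set x in [set i; j] | (x < i)%N] = set0.
  apply/setP => x; rewrite !inE; case: eqP => [->|_] /=; first by rewrite ltnn.
  by case: eqP => [->|] //=; rewrite ltnNge ltnW.
have -> : [set x in [set i; j] | (x < j)%N] = [set i].
  apply/setP => x; rewrite !inE; case: eqP => [->|_] /=; first by rewrite ij.
  by case: eqP => [->|] //=; rewrite ltnn.
have -> : [set i; j] :\ i = [set j] by rewrite setU1K.
have -> : [set i; j] :\ j = [set i] by rewrite setUC setU1K // inE eq_sym -in_set1.
by rewrite cards0 cards1 expr0 expr1 mul1r mulN1r.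
Qed.

(** If H^j vanishes, every form is zero on cocycles, so 1 lies in the annihilator and no prime
    contains it. *)
Lemma dual_dim_acyclic J j m :
  (forall c, cech_cocycle J j c -> cech_coboundary J j c) -> ~ dual_dim_ge J j m.
Proof.
move=> acyclic [l [[P [primeP annP _]] _]].
case: (primeP 0%N) => // _ P1 _; apply/P1/annP => phi [_ phi0 _] c cc.
have -> : cochain_scale 1 c = c by apply/ffunP => A; rewrite ffunE tofrac1 mul1r.
by apply: phi0 => //; apply: acyclic.
Qed.

Section Symbolic.
Variables (Delta : {set {set 'I_n}}) (l : nat).
Local Notation J := (mideal (symbolic_exponent Delta l) : S -> Prop).
Hypothesis facet_gt1 : forall F, F \in facets Delta -> (1 < #|F|)%N.

Lemma primary_varX F i N f : i \in F -> primary l F ('X_i ^+ N * f) -> primary l F f.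
Proof.
move=> iF; have regi : nonzerodivisor (primary l F) ('X_i : S).
  by apply: primary_nonzerodivisor; rewrite face_primeX iF.
elim: N => [|N IH]; first by rewrite expr0 mul1r.
by rewrite exprS -mulrA => /regi.
Qed.

(** A 0-cocycle is a polynomial f that a power of each variable multiplies into J. Every facet has a
    vertex, and its variable is regular modulo the component of the facet, so f lies in all
    components. *)
Lemma cech_H0 c : cech_cocycle J 0 c -> cech_coboundary J 0 c.
Proof.
case=> c0 c1; exists 0; split=> [A|]; first by rewrite ffunE.
have -> : c - cech_diff 0 = c.
  apply/ffunP => A; rewrite !ffunE big1 ?oppr0 ?addr0 // => i _.
  by rewrite ffunE mulr0.
move=> A; have := c0 A; case: ifP => //; rewrite cards_eq0 => /eqP-> [f [N [_ cE]]].
have c0E : c set0 = tofrac f by rewrite cE /monomial_of big_set0 expr1n tofrac1 divr1.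
exists f, 0%N; split; last by rewrite expr0 tofrac1 divr1.
apply/symbolicP => F FD; have /card_gt0P[i iF] := ltnW (facet_gt1 FD).
have := c1 [set i]; rewrite cards1 eqxx cech_diff1 c0E /in_localization monomial_of1.
case=> g [M [Jg]]; have -> : tofrac f = tofrac f / tofrac 1 :> FracS by rewrite tofrac1 divr1.
rewrite frac_eq ?oner_eq0 ?expf_neq0 ?mpolyX_neq0 // mulr1 mulrC => fE; apply: (primary_varX (N := M) iF).
by rewrite fE; move/symbolicP: Jg; apply.
Qed.

(* On the component of a facet F a cocycle c extends to a polynomial s_F, since F
   has at least two vertices; linkedness allows to glue the s_F to a polynomial
   whose coboundary is c. *)
Lemma cech_H1 c : linked Delta l -> cech_cocycle J 1 c -> cech_coboundary J 1 c.
Proof.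
move=> lk [c1 c2].
have [a [N aN]] : exists (a : 'I_n -> S) (N : 'I_n -> nat),
    forall i, c [set i] = tofrac (a i) / tofrac ('X_i ^+ N i).
  suff [aN H] : exists aN : 'I_n -> S * nat, forall i,
      c [set i] = tofrac (aN i).1 / tofrac ('X_i ^+ (aN i).2).
    by exists (fun i => (aN i).1), (fun i => (aN i).2).
  apply: (fin_all_exists (P := fun i (aN : S * nat) =>
    c [set i] = tofrac aN.1 / tofrac ('X_i ^+ aN.2))) => i.
  have := c1 [set i]; rewrite cards1 eqxx /in_localization monomial_of1 => -[f [M [_ ->]]].
  by exists (f, M).
have Xn0 i M : 'X_i ^+ M != 0 :> S by rewrite expf_neq0 ?mpolyX_neq0.
(* The cocycle condition with denominators cleared: powers of X_i and X_j cancel because both are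
   regular modulo the component of F. *)
have cocycle F i j : F \in facets Delta -> i \in F -> j \in F ->
    primary l F (a i * 'X_j ^+ N j - a j * 'X_i ^+ N i).
  move=> FD; have [_ FDD FM] := primary_ideal k l F.
  wlog ij : i j / (i < j)%N => [IH iF jF|iF jF].
    have [ij|ji|/val_inj->] := ltngtP i j; first exact: IH.
      by rewrite -opprB; apply: (ideal_opp (primary_ideal k l F)); apply: IH.
    by rewrite subrr; case: (primary_ideal k l F).
  have nij : i \notin [set j] by rewrite inE neq_ltn ij.
  have := c2 [set i; j]; rewrite cardsU1 nij cards1 eqxx cech_diff2 //.
  case=> g [M [/symbolicP/(_ F FD) Fg]]; rewrite !aN /monomial_of big_setU1 //= big_set1.
  rewrite frac_sub ?Xn0 // frac_eq ?mulf_neq0 ?expf_neq0 ?mulf_neq0 ?mpolyX_neq0 // exprMn => E.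
  apply: (primary_varX (N := M) iF); apply: (primary_varX (N := M) jF).
  have -> : 'X_j ^+ M * ('X_i ^+ M * (a i * 'X_j ^+ N j - a j * 'X_i ^+ N i)) =
      - ('X_j ^+ N j * 'X_i ^+ N i) * g :> S.
    by rewrite mulNr [_ * g]mulrC -E; ring.
  exact: FM.
have [s sP] : exists s : {set 'I_n} -> S, forall F, F \in facets Delta ->
    forall i, i \in F -> primary l F (a i - 'X_i ^+ N i * s F).
  apply: (fin_all_exists (P := fun F s => F \in facets Delta ->
    forall i, i \in F -> primary l F (a i - 'X_i ^+ N i * s))) => F.
  have [FD|_] := boolP (F \in facets Delta); last by exists 0.
  have idF := primary_ideal k l F; case: (idF) => _ FA FM.
  have /card_gt1P[i0 [j0 [iF jF ij]]] := facet_gt1 FD.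
  (* The variable of a second vertex j0 is regular modulo P_F^l + (X_i0^N), so the cocycle relation
     makes [a i0] a multiple of X_i0^N modulo P_F^l; the quotient is the required polynomial. *)
  pose E m := (l <= wt F m)%N || (U_(i0) *+ N i0 <= m)%MM.
  have upE : upclosed E by apply/upclosed_or/upclosed_wt.
  have Ea : mideal E (a i0).
    have : mideal E ('X_j0 ^+ N j0 * a i0).
      rewrite mpolyXn /E -mideal_addX; last exact: upclosed_wt.
      apply/(ideal_add1P _ _ idF); exists (a j0).
      by rewrite -!mpolyXn ['X_j0 ^+ _ * _]mulrC ['X_i0 ^+ _ * _]mulrC; apply: cocycle.
    rewrite mpolyXn mideal_colon // (@eq_mideal _ _ _ E) // => m.
    rewrite /E wtD (_ : wt F _ = 0%N) ?add0n; last first.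
      apply/eqP/wt_eq0P => i iF'; rewrite mulmnE mnm1E.
      by case: eqP iF' => // <-; rewrite jF.
    congr (_ || _); apply/mnm_lepP/mnm_lepP => H i; have := H i; rewrite mnmDE !mulmnE !mnm1E.
      have [<-|_] := eqVneq i0 i; last by rewrite mul0n.
      by rewrite eq_sym (negbTE ij) mul0n.
    by move=> H'; apply: leq_trans H' (leq_addl _ _).
  move: Ea; rewrite /E -mideal_addX; last exact: upclosed_wt.
  case/(ideal_add1P _ _ idF) => s; rewrite -mpolyXn => Fs; exists s => _ i iF'.
  apply: (primary_varX (N := N i0) iF).
  have -> : 'X_i0 ^+ N i0 * (a i - 'X_i ^+ N i * s) =
     'X_i ^+ N i * (a i0 - 'X_i0 ^+ N i0 * s)
     + (a i * 'X_i0 ^+ N i0 - a i0 * 'X_i ^+ N i) by ring.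
  by apply: FA; [apply: FM | apply: cocycle].
have [F H FD HD /set0Pn[i]|t tP] := @glue k n Delta l s lk.
  rewrite in_setI => /andP[iF iH]; have idM := mixed_ideal k l F H.
  have regi : nonzerodivisor (mixed l F H) ('X_i : S).
    by apply: mixed_nonzerodivisor; rewrite face_primeX in_setI iF iH.
  have : mixed l F H ('X_i ^+ N i * (s F - s H)).
    have -> : 'X_i ^+ N i * (s F - s H) =
      (a i - 'X_i ^+ N i * s H) - (a i - 'X_i ^+ N i * s F) by ring.
    apply: (ideal_sub idM); first exact/primary_mixedr/sP.
    exact/primary_mixedl/sP.
  by elim: (N i) => [|M IH]; rewrite ?expr0 ?mul1r // exprS -mulrA => /regi.
(* The factor X_i^l, invertible in the localization, lies in P_F^l for every facet F that avoids i;
   only the facets through i remain to be checked. *)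
have at_ i : J ('X_i ^+ l * (a i - 'X_i ^+ N i * t)).
  apply/symbolicP => F FD; have [_ FA FM] := primary_ideal k l F.
  have [iF|iF] := boolP (i \in F).
    have -> : a i - 'X_i ^+ N i * t = (a i - 'X_i ^+ N i * s F) - 'X_i ^+ N i * (t - s F) by ring.
    apply: (FM); apply: (ideal_sub (primary_ideal k l F)); first exact: sP.
    by apply: FM; apply: tP.
  rewrite mulrC; apply: FM; rewrite mpolyXn; apply/midealX.
  rewrite (_ : wt F _ = l) // -[RHS]mul1n.
  rewrite /wt (bigD1 i) //= mulmnE mnm1E eqxx big1 ?addn0 // => j /andP[_ /negbTE ji].
  by rewrite mulmnE mnm1E eq_sym ji.
exists [ffun A => if A == set0 then tofrac t else 0]; split=> [A|A].
  rewrite ffunE eqSS cards_eq0; case: eqP => // ->.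
  by exists t, 0%N; rewrite expr0 tofrac1 divr1.
case: (boolP (#|A| == 1%N)) => [/cards1P[i ->]|A1].
  have -> : (c - cech_diff [ffun A => if A == set0 then tofrac t else 0]) [set i] =
      c [set i] - tofrac t by rewrite ffunE [X in _ + X]ffunE cech_diff1 ffunE eqxx.
  exists ('X_i ^+ l * (a i - 'X_i ^+ N i * t)), (l + N i)%N; split=> //.
  have -> : tofrac t = tofrac t / tofrac 1 :> FracS by rewrite tofrac1 divr1.
  rewrite aN monomial_of1 frac_sub ?oner_eq0 //.
  by apply/frac_eq; rewrite ?mulf_neq0 ?oner_eq0 ?Xn0 // exprD; ring.
have cA : c A = 0 by have := c1 A; rewrite (negbTE A1).
rewrite ffunE cA add0r [LHS]ffunE ffunE big1 ?oppr0 // => i iA.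
rewrite ffunE; case: eqP => [A0|]; last by rewrite mulr0.
by case/negP: A1; rewrite (cardsD1 i) iA A0 cards0.
Qed.

End Symbolic.
End LocalCohomology.

(** * Elementary symmetric polynomials as parameters *)

Section ElementarySymmetric.
Variables (k : fieldType) (n : nat).
Local Notation S := {mpoly k[n]}.
Implicit Types (lq : n.-tuple S) (A : {set 'I_n}) (f g : S).

(** Defined through the generating polynomial, so that a substitution that kills most variables
    leaves a product of few factors. *)
Definition elem_sym j : S := (\prod_(i < n) (1 + 'X_i *: 'X : {poly S}))`_j.

Lemma elem_sym_comp j lq :
  elem_sym j \mPo lq = (\prod_(i < n) (1 + tnth lq i *: 'X : {poly S}))`_j.
Proof.
rewrite /elem_sym -(coef_map (comp_mpoly lq)) rmorph_prod /=; congr (polyseq _)`_j.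
apply: eq_bigr => i _; rewrite rmorphD rmorph1 /= map_polyZ map_polyX /=.
by rewrite comp_mpolyXU -tnth_nth.
Qed.

Lemma prod_linear1 lq p : (forall i, i != p -> tnth lq i = 0) ->
  \prod_(i < n) (1 + tnth lq i *: 'X : {poly S}) = 1 + tnth lq p *: 'X.
Proof.
move=> lq0; rewrite (bigD1 p) //= big1 ?mulr1 // => i /lq0 ->.
by rewrite scale0r addr0.
Qed.

Lemma prod_linear3 lq p q r : p != q -> p != r -> q != r ->
  (forall i, i \notin [set p; q; r] -> tnth lq i = 0) ->
  let a := tnth lq p in let b := tnth lq q in let c := tnth lq r in
  \prod_(i < n) (1 + tnth lq i *: 'X : {poly S}) =
  Poly [:: 1; a + b + c; a * b + a * c + b * c; a * b * c].
Proof.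
move=> pq pr qr lq0 a b c; rewrite (bigD1 p) //= (bigD1 q) 1?eq_sym //= (bigD1 r) /=; last first.
  by rewrite ![r == _]eq_sym pr qr.
rewrite big1 => [|i /andP[/andP[ip iq] ir]]; last first.
  by rewrite lq0 ?scale0r ?addr0 // !inE !negb_or ip iq.
rewrite -/a -/b -/c mulr1 -!mul_polyC /= !cons_poly_def mul0r add0r !polyCD !polyCM; ring.
Qed.

Lemma mcoeff0_elem_sym j : (elem_sym j.+1)@_0 = 0.
Proof.
rewrite /elem_sym -(coef_map (mcoeff 0%MM)) rmorph_prod /= big1 ?coef1 // => i _.
rewrite rmorphD rmorph1 /= map_polyZ map_polyX /= mcoeffX mnm1_eq0 scale0r addr0 //.
Qed.

Lemma max_idealE f : f@_0 = 0 -> max_ideal f.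
Proof.
move=> f0; rewrite (mpolyE f); apply: ideal_sum => [|m _]; first exact: ideal_span_ideal.
have [I0 _ IM] := ideal_span_ideal (fun f : S => exists i : 'I_n, f = 'X_i).
have [->|m0] := eqVneq m 0%MM; first by rewrite f0 scale0r.
have [i mi] : exists i, (0 < m i)%N.
  apply: NNPP => H; case/eqP: m0; apply/mnmP => i; rewrite mnm0E.
  by apply/eqP; rewrite eqn0Ngt; apply/negP => mi; apply: H; exists i.
rewrite -mul_mpolyC (subm1K mi) mpolyXD; apply: (IM); rewrite mulrC; apply: IM.
by apply: ideal_span_gen; exists i.
Qed.

Definition var_subst (j : 'I_n) (b : S) : n.-tuple S :=
  [tuple (if i == j then b else 'X_i) | i < n].

Lemma compX lq i : 'X_i \mPo lq = tnth lq i.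
Proof. by rewrite comp_mpolyXU -tnth_nth. Qed.

Lemma compX_var_subst j b i : 'X_i \mPo var_subst j b = if i == j then b else 'X_i.
Proof. by rewrite compX tnth_mktuple. Qed.

Lemma var_subst_dvd j b f : f \mPo var_subst j b = 0 -> exists g, f = ('X_j - b) * g.
Proof.
move=> f0; rewrite -[f]subr0 -f0.
apply: (@comp_mpoly_congr _ _ (fun f => exists g, f = ('X_j - b) * g)) => [|i].
  split=> [|f1 f2 [g1 ->] [g2 ->]|a f1 [g1 ->]].
  - by exists 0; rewrite mulr0.
  - by exists (g1 + g2); rewrite mulrDr.
  - by exists (a * g1); rewrite mulrCA.
rewrite tnth_mktuple; case: eqP => [->|_]; first by exists 1; rewrite mulr1.
by exists 0; rewrite subrr mulr0.
Qed.

Section Three.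
Variables p q r : 'I_n.
Hypotheses (pq : p != q) (pr : p != r) (qr : q != r).
Local Notation F := [set p; q; r].
Local Notation x := ('X_q : S).
Local Notation y := ('X_r : S).
Local Notation Q := (x ^+ 2 + x * y + y ^+ 2).

Let rq : (r == q) = false. Proof. by rewrite eq_sym (negbTE qr). Qed.

Lemma quadric_neq0 : Q != 0.
Proof.
apply/eqP => /(congr1 (fun f => f \mPo var_subst q 0)).
rewrite comp_mpoly0 !(rmorphD, rmorphM, rmorphXn) /= !compX_var_subst eqxx rq.
move=> E; have /eqP : y ^+ 2 = 0 by rewrite -E; ring.
by rewrite expf_eq0 /=; apply/negP/mpolyX_neq0.
Qed.

(* Each linear factor of e3 = - x y (x + y) is prime and does not divide the
   quadric. *)
Lemma quadric_coprime g h : x * y * (x + y) * g = Q * h -> exists h', g = Q * h'.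
Proof.
have dvd j b g1 h1 : 'X_j - b != 0 -> b \mPo var_subst j b = b -> Q \mPo var_subst j b != 0 ->
    ('X_j - b) * g1 = Q * h1 -> exists h2, g1 = Q * h2.
  move=> j0 bK Q0 E; have /var_subst_dvd [h2 h2E] : h1 \mPo var_subst j b = 0.
    have /eqP := congr1 (fun f => f \mPo var_subst j b) E.
    rewrite [X in X == _]rmorphM [X in _ == X]rmorphM rmorphB /= compX_var_subst eqxx bK subrr.
    by rewrite mul0r eq_sym mulf_eq0 (negbTE Q0) => /eqP.
  exists h2; apply: (mulfI j0); rewrite E h2E; ring.
have QE j b : Q \mPo var_subst j b = ('X_q \mPo var_subst j b) ^+ 2
    + ('X_q \mPo var_subst j b) * ('X_r \mPo var_subst j b) + ('X_r \mPo var_subst j b) ^+ 2.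
  by rewrite !(rmorphD, rmorphM, rmorphXn).
have y0 : y ^+ 2 != 0 by rewrite expf_neq0 ?mpolyX_neq0.
have x0 : x ^+ 2 != 0 by rewrite expf_neq0 ?mpolyX_neq0.
have xy0 : x + y != 0.
  apply/eqP => /(congr1 (fun f => f \mPo var_subst q 0)).
  rewrite comp_mpoly0 rmorphD /= !compX_var_subst eqxx rq add0r => /eqP.
  by apply/negP/mpolyX_neq0.
have E1 u h0 : x * u = Q * h0 -> exists h1, u = Q * h1.
  rewrite -[X in X * _]subr0; apply: dvd; rewrite ?subr0 ?mpolyX_neq0 ?comp_mpoly0 //.
  by rewrite QE !compX_var_subst eqxx rq expr0n mul0r !add0r.
have E2 u h0 : y * u = Q * h0 -> exists h1, u = Q * h1.
  rewrite -[X in X * _]subr0; apply: dvd; rewrite ?subr0 ?mpolyX_neq0 ?comp_mpoly0 //.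
  by rewrite QE !compX_var_subst eqxx (negbTE qr) expr0n mulr0 !addr0.
have E3 u h0 : (x + y) * u = Q * h0 -> exists h1, u = Q * h1.
  rewrite -[y in x + y]opprK; apply: dvd; rewrite ?opprK //.
    by rewrite rmorphN /= compX_var_subst rq.
  rewrite QE !compX_var_subst eqxx rq (_ : _ + _ = y ^+ 2) //; ring.
rewrite -!mulrA => /E1 [h1] /E2 [h2] /E3 //.
Qed.

(** This substitution presents S/(P_F + (e1)) as the polynomial ring in x and y, with X_p = - x - y;
    it sends e2 to - Q and e3 to - x y (x + y). *)
Let lq : n.-tuple S := [tuple (if i == p then - x - y else if i \in F then 'X_i else 0) | i < n].

Let lqp : tnth lq p = - x - y.
Proof. by rewrite tnth_mktuple eqxx. Qed.

Let lqq : tnth lq q = x.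
Proof. by rewrite tnth_mktuple eq_sym (negbTE pq) !inE eqxx orbT. Qed.

Let lqr : tnth lq r = y.
Proof. by rewrite tnth_mktuple eq_sym (negbTE pr) !inE eqxx !orbT. Qed.

Let lq0 i : i \notin F -> tnth lq i = 0.
Proof.
move=> iF; rewrite tnth_mktuple (negbTE iF).
by case: eqP iF => // ->; rewrite !inE eqxx.
Qed.

Let elem_sym_lq j : elem_sym j \mPo lq = [:: 1; 0; - Q; - (x * y * (x + y))]`_j.
Proof.
rewrite elem_sym_comp (prod_linear3 pq pr qr lq0) lqp lqq lqr coef_Poly.
by case: j => [|[|[|[|j]]]] //=; ring.
Qed.

Let elem_sym1_face : elem_sym 1 \mPo face_subst k F = 'X_p + x + y.
Proof.
rewrite elem_sym_comp (@prod_linear3 (face_subst k F) p q r) // => [|i iF]; last first.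
  by rewrite tnth_mktuple (negbTE iF).
by rewrite coef_Poly /= !tnth_mktuple !inE !eqxx !orbT.
Qed.

Let kernel_lq f : ideal_add (@face_prime k n F) [:: elem_sym 1] f <-> f \mPo lq = 0.
Proof.
have [[Z0 ZD ZM] _ _] := kernel_prime lq; split.
  apply: (ideal_span_min (I := fun f => f \mPo lq = 0)) => // g [|].
    exact: face_prime_comp lq0.
  by rewrite inE => /eqP->; rewrite elem_sym_lq.
have [I0 ID IM] := ideal_add_ideal (@face_prime k n F) [:: elem_sym 1 : S].
move=> f0; rewrite -[f]subr0 -f0; apply: comp_mpoly_congr => // i.
have [->|ip] := eqVneq i p; last first.
  rewrite tnth_mktuple (negbTE ip); case: ifP => iF; first by rewrite subrr.
  by rewrite subr0; apply/ideal_addW/face_primeX; rewrite iF.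
rewrite lqp (_ : 'X_p - (- x - y) = elem_sym 1 - (elem_sym 1 - (elem_sym 1 \mPo face_subst k F))); last first.
  by rewrite elem_sym1_face; ring.
apply: (ideal_sub (ideal_add_ideal _ _)); first exact/ideal_add_mem/mem_head.
apply: ideal_addW.
apply: (@comp_mpoly_congr k n (@face_prime k n F) (face_subst k F) (elem_sym 1)
  (face_prime_ideal k F)) => j.
rewrite tnth_mktuple; case: ifP => jF; first by rewrite subrr; case: (face_prime_ideal k F).
by rewrite subr0; apply/face_primeX; rewrite jF.
Qed.

Let lqK f : (f \mPo lq) \mPo lq = f \mPo lq.
Proof.
apply/esym/eqP; rewrite -subr_eq0 -rmorphB /=; apply/eqP.
have [[Z0 ZD ZM] _ _] := kernel_prime lq.
apply: (@comp_mpoly_congr _ _ (fun f => f \mPo lq = 0)) => // i.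
rewrite rmorphB /= compX; have [->|ip] := eqVneq i p.
  by rewrite lqp rmorphB rmorphN /= !compX lqq lqr subrr.
rewrite [X in _ - (X \mPo _)]tnth_mktuple (negbTE ip); case: ifP => iF; first by rewrite compX subrr.
by rewrite lq0 ?iF // comp_mpoly0 subrr.
Qed.

(** The quotients by P_F and by P_F + (e1) are domains in which e1, respectively e2, is nonzero. The
    third step is the coprimality of the images of e2 and e3, lifted back through the idempotence of
    [lq]; it holds in every characteristic. *)
Lemma elem_sym_regular : weakly_regular (@face_prime k n F) [:: elem_sym 1; elem_sym 2; elem_sym 3].
Proof.
have kerE : ideal_add (@face_prime k n F) [:: elem_sym 1] = (fun f => f \mPo lq = 0).
  exact: predeqP kernel_lq.
split; last split; last split=> //.
- apply: nonzerodivisor_prime; first exact: face_prime_prime.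
  rewrite face_primeE elem_sym1_face => /(congr1 (mcoeff U_(p)%MM)).
  rewrite !mcoeffD !mcoeffXU eqxx mcoeff0 !(eq_sym _ p) (negbTE pq) (negbTE pr) !addr0.
  exact/eqP/oner_neq0.
- rewrite kerE; apply: nonzerodivisor_prime; first exact: kernel_prime.
  by rewrite elem_sym_lq /=; apply/eqP; rewrite oppr_eq0 quadric_neq0.
- move=> g; rewrite kerE; have [idK _ _] := kernel_prime lq.
  case/(ideal_add1P _ _ idK) => h /eqP; rewrite rmorphB subr_eq0 !rmorphM /= !elem_sym_lq /=.
  rewrite !mulNr eqr_opp => /eqP/quadric_coprime[h' gE].
  apply/(ideal_add1P _ _ idK); exists (- h').
  rewrite rmorphB rmorphM rmorphN /= elem_sym_lq /= mulrNN -[g \mPo lq]lqK gE.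
  by rewrite rmorphM /= !(rmorphD, rmorphM, rmorphXn) /= !compX lqq lqr subrr.
Qed.

End Three.

(** At a single vertex e1 restricts to X_i. Gluing needs this, as components may meet in one vertex
    only. *)
Lemma elem_sym1_notin i : ~ face_prime [set i] (elem_sym 1).
Proof.
rewrite face_primeE elem_sym_comp (@prod_linear1 _ i) => [|j ji]; last first.
  by rewrite tnth_mktuple inE (negbTE ji).
rewrite coefD coef1 coefZ coefX /= add0r mulr1 tnth_mktuple inE eqxx.
by apply/eqP/mpolyX_neq0.
Qed.

End ElementarySymmetric.

(** * The complex *)

Section Shelling.
Variable n : nat.
Implicit Types (F G : {set 'I_n}) (s : seq {set 'I_n}).

Lemma generatedP s G :
  reflect (exists2 F, F \in s & G \subset F) (G \in generated_complex s).
Proof. by rewrite inE; apply: hasP. Qed.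

Lemma facets_generated s d : (forall F, F \in s -> #|F| = d) ->
  facets (generated_complex s) =i s.
Proof.
move=> cards F; rewrite inE; apply/maxsetP/idP => [[/generatedP[G Gs FG] maxF]|Fs].
  by rewrite -(maxF G) //; apply/generatedP; exists G.
split=> [|G /generatedP[H Hs GH] FG]; first by apply/generatedP; exists F.
by apply/esym/eqP; rewrite eqEcard FG (cards F Fs) -(cards H Hs) subset_leq_card.
Qed.

Lemma complex_dim_generated s d : s != [::] -> (forall F, F \in s -> #|F| = d) ->
  complex_dim (generated_complex s) = d%:Z - 1.
Proof.
move=> s0 cards; congr (Posz _ - 1); apply/eqP; rewrite eqn_leq; apply/andP; split.
  apply/bigmax_leqP => G /generatedP[F Fs GF].
  by rewrite -(cards F Fs) subset_leq_card.
case: s s0 cards => // F s _ cards; rewrite -(cards F (mem_head _ _)).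
apply: (@leq_bigmax_cond _ _ (fun G : {set 'I_n} => #|G|)).
by apply/generatedP; exists F => //; apply: mem_head.
Qed.

(** A face of F inside an earlier G misses some v of F outside G, hence lies in F minus v, which is
    itself an earlier face. So the facets of the intersection all have one vertex less than F. *)
Lemma shelling_step s F : s != [::] ->
  (forall G, G \in s -> exists v,
    [/\ v \in F, v \notin G & exists2 H, H \in s & F :\ v \subset H]) ->
  let Gamma := generated_complex s :&: generated_complex [:: F] in
  pure Gamma /\ complex_dim Gamma = face_dim F - 1.
Proof.
move=> s0 step Gamma.
have GammaF v : v \in F -> (exists2 H, H \in s & F :\ v \subset H) -> F :\ v \in Gamma.
  move=> vF Hs; rewrite inE; apply/andP; split; first exact/generatedP.
  by apply/generatedP; exists F; rewrite ?mem_head // subD1set.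
have GammaP G : G \in Gamma -> exists v, [/\ v \in F, F :\ v \in Gamma & G \subset F :\ v].
  rewrite inE => /andP[/generatedP[H Hs GH] /generatedP[F']].
  rewrite inE => /eqP-> GF; have [v [vF vH Fv]] := step H Hs.
  exists v; split; rewrite ?GammaF //; apply/subsetP => i iG; rewrite !inE (subsetP GF) // andbT.
  by apply: contraNneq vH => <-; apply: (subsetP GH).
have cardF v : v \in F -> #|F :\ v| = #|F|.-1 by move=> vF; rewrite (cardsD1 v F) vF.
split.
  suff fcard G : G \in facets Gamma -> #|G| = #|F|.-1.
    by move=> G H /fcard Gc /fcard Hc; rewrite /face_dim Gc Hc.
  rewrite inE => /maxsetP[GG maxG]; have [v [vF Fv Gv]] := GammaP G GG.
  by rewrite -(maxG _ Fv Gv) cardF.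
have [v [vF vG Fv]] : exists v, [/\ v \in F, v \notin head F s
    & exists2 H, H \in s & F :\ v \subset H].
  by apply: step; case: (s) s0 => // G s' _; apply: mem_head.
have F_gt0 : (0 < #|F|)%N by apply/card_gt0P; exists v.
rewrite /complex_dim /face_dim (_ : \max_(G in Gamma) #|G| = #|F|.-1)%N; first by lia.
apply/eqP; rewrite eqn_leq; apply/andP; split.
  apply/bigmax_leqP => G /GammaP[w [wF _ /subset_leq_card]].
  by rewrite cardF.
rewrite -(cardF v vF); apply: (@leq_bigmax_cond _ _ (fun G : {set 'I_n} => #|G|)).
exact: GammaF.
Qed.

End Shelling.

(** * Faces and exponents as lists of numbers, for evaluation *)

Section ListFaces.
Variable n : nat.
Implicit Types (s t w : seq nat).

Definition list_face s : {set 'I_n} := [set i | val i \in s].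

Definition list_mnm w : 'X_{1..n} := [multinom nth 0%N w i | i < n].

Definition list_wt s w : nat :=
  sumn [seq (if i \in s then 0%N else nth 0%N w i) | i <- iota 0 n].

Lemma in_list_face s i : (i \in list_face s) = (val i \in s).
Proof. by rewrite inE. Qed.

Lemma card_list_face s : uniq s -> all (fun i => i < n)%N s -> #|list_face s| = size s.
Proof.
move=> us /allP sn; rewrite cardE -(size_map val); apply: perm_size; apply: uniq_perm => //.
  by rewrite map_inj_uniq ?enum_uniq //; apply: val_inj.
move=> i; apply/mapP/idP => [[j]|is_].
  by rewrite mem_enum in_list_face => js ->.
by exists (Ordinal (sn i is_)); rewrite // mem_enum in_list_face.
Qed.

Lemma wt_list s (m : 'X_{1..n}) w :
  (forall i : 'I_n, m i = nth 0%N w i) -> wt (list_face s) m = list_wt s w.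
Proof.
move=> mw; rewrite /wt big_mkcond /list_wt sumnE big_map.
have -> : iota 0 n = index_iota 0 n by rewrite /index_iota subn0.
rewrite big_mkord; apply: eq_bigr => i _.
by rewrite in_list_face mw; case: (_ \in _).
Qed.

Lemma wt_list_mnm s w : wt (list_face s) (list_mnm w) = list_wt s w.
Proof. by apply: wt_list => i; rewrite mnmE. Qed.

Lemma list_values (m : 'X_{1..n}) : exists2 w, size w = n & forall i : 'I_n, m i = nth 0%N w i.
Proof.
exists [seq m i | i <- enum 'I_n]; first by rewrite size_map size_enum_ord.
by move=> i; rewrite (nth_map i) ?size_enum_ord // nth_ord_enum.
Qed.

End ListFaces.

(** The triangles through the apex come before T and U: this order is a shelling, and it also
    governs the filtration for the second symbolic power. *)
Definition facet_lists : seq (seq nat) :=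
  [seq [:: i; j; 6] | i <- iota 0 6, j <- iota i.+1 (5 - i)] ++ [:: [:: 0; 1; 2]; [:: 3; 4; 5]]%N.

Arguments facet_lists : simpl never.

Notation face := (@list_face 7).

Definition cone_two_triangles : {set {set 'I_7}} :=
  generated_complex [seq face s | s <- facet_lists].

Lemma facet_listsP s : s \in facet_lists ->
  [/\ size s = 3, sorted ltn s & all (fun i => i < 7)%N s].
Proof.
have : all (fun s => [&& size s == 3, sorted ltn s & all (fun i => i < 7)%N s]) facet_lists by [].
by move/allP => H /H /and3P[/eqP].
Qed.

Lemma card_face s : s \in facet_lists -> #|face s| = 3.
Proof.
case/facet_listsP => sz st s7; rewrite card_list_face //.
by apply: sorted_uniq st; [apply: ltn_trans | apply: ltnn].
Qed.

Lemma facetsE : facets cone_two_triangles =i [seq face s | s <- facet_lists].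
Proof. by apply: (@facets_generated _ _ 3) => _ /mapP[s sfl ->]; apply: card_face. Qed.

Lemma facetsP F :
  reflect (exists2 s, s \in facet_lists & F = face s) (F \in facets cone_two_triangles).
Proof. by rewrite facetsE; apply: mapP. Qed.

Lemma card_facet F : F \in facets cone_two_triangles -> #|F| = 3.
Proof. by case/facetsP => s sfl ->; apply: card_face. Qed.

Lemma face_subset s t : all (mem t) s -> face s \subset face t.
Proof. by move=> /allP st; apply/subsetP => i; rewrite !in_list_face => /st. Qed.

Lemma complex_cone_two_triangles : simplicial_complex cone_two_triangles.
Proof.
split=> [|F G /generatedP[H Hs FH] GF|i].
- by apply/generatedP; exists (face [:: 0; 1; 2]%N); rewrite ?sub0set // map_f.
- by apply/generatedP; exists H; rewrite // (subset_trans GF).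
have : all (fun i : nat => has (fun s : seq nat => i \in s) facet_lists) (iota 0 7) by [].
move/allP/(_ (val i)); rewrite mem_iota ltn_ord => /(_ isT)/hasP[s sfl is_].
by apply/generatedP; exists (face s); rewrite ?map_f // sub1set in_list_face.
Qed.

Lemma dim_cone_two_triangles : complex_dim cone_two_triangles = 3%:Z - 1.
Proof. by apply: complex_dim_generated => // _ /mapP[s sfl ->]; apply: card_face. Qed.

Lemma not_cone_cone_two_triangles : ~ cone cone_two_triangles.
Proof.
case=> v vF.
have := vF (face [:: 0; 1; 2]%N); have := vF (face [:: 3; 4; 5]%N).
rewrite !facetsE !map_f // !in_list_face => /(_ isT) v1 /(_ isT) v2.
have : ~~ has (fun i => i \in [:: 0; 1; 2]%N) [:: 3; 4; 5]%N by [].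
by case/hasP; exists (val v).
Qed.

Lemma pure_cone_two_triangles : pure cone_two_triangles.
Proof. by move=> F G /card_facet Fc /card_facet Gc; rewrite /face_dim Fc Gc. Qed.

Lemma shellable_cone_two_triangles : shellable cone_two_triangles.
Proof.
exists [seq face s | s <- facet_lists]; split=> [|F|j].
- rewrite map_inj_in_uniq // => s t sfl tfl E.
  have : all (fun s : seq nat => all (fun t : seq nat => all (fun i : nat => (i \in s) == (i \in t)) (iota 0 7) ==> (s == t))
    facet_lists) facet_lists by vm_compute.
  move/allP/(_ s sfl)/allP/(_ t tfl)/implyP => st; apply/eqP/st/allP => i.
  rewrite mem_iota => i7; have /setP/(_ (Ordinal i7)) := E.
  by rewrite !in_list_face => ->.
- by rewrite facetsE.
rewrite size_map => /andP[j0 jm]; cbv zeta; rewrite -map_take (nth_map [::]) //.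
apply: (@shelling_step _ [seq face s | s <- take j facet_lists] (face (nth [::] facet_lists j))).
  by rewrite -size_eq0 size_map size_takel -?lt0n // ltnW.
move=> _ /mapP[s sj ->]; set u := nth _ _ _.
have : all (fun j => all (fun s : seq nat => has (fun v : nat => (v \notin s) &&
    has (fun t : seq nat => all (fun i => (i == v) || (i \in t)) (nth [::] facet_lists j))
      (take j facet_lists)) (nth [::] facet_lists j)) (take j facet_lists))
    (iota 1 (size facet_lists).-1) by vm_compute.
move/allP/(_ j); rewrite mem_iota j0 jm => /(_ isT)/allP/(_ s sj)/hasP[v vu /andP[vs /hasP[t tj ut]]].
have [_ _ /allP u7] := facet_listsP (mem_nth [::] jm).
exists (Ordinal (u7 v vu)); rewrite !in_list_face; split=> //.
exists (face t); first exact: map_f.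
apply/subsetP => i; rewrite in_setD1 !in_list_face => /andP[iv /(allP ut)/orP[|//]].
by rewrite -val_eqE /= in iv; rewrite (negbTE iv).
Qed.

Definition lists_meet (s t : seq nat) := has (mem t) s.

(** Two facets that meet are linked through either of them. If two disjoint facets have weight at
    most 4, the exponents on T and on U each sum to at most 4. Omitting the largest exponent of T,
    at i, and of U, at j, leaves sums of at most 2, so {i, j, 6} has weight at most 4 and meets both
    facets. *)
Lemma linked_cone_two_triangles : linked cone_two_triangles 5.
Proof.
have meetP s t : s \in facet_lists -> lists_meet s t -> face s :&: face t != set0.
  case/facet_listsP => _ _ /allP s7 /hasP[i is_ it]; apply/set0Pn.
  by exists (Ordinal (s7 i is_)); rewrite in_setI !in_list_face is_.
move=> m _ _ /facetsP[s sfl ->] /facetsP[t tfl ->].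
have [w sz mw] := list_values m; rewrite !(wt_list _ mw) => sw tw.
suff /hasP[u ufl /and3P[uw su ut]] : has (fun u => [&& (list_wt 7 u w < 5)%N,
    lists_meet s u & lists_meet u t]) facet_lists.
  exists (face u); rewrite (wt_list _ mw).
  by split; rewrite ?meetP // facetsE map_f.
have [st|st] := boolP (lists_meet s t).
  apply/hasP; exists s => //; rewrite sw st andbT.
  have [+ _ _] := facet_listsP sfl; case: (s) => // i s' _.
  by rewrite /= inE eqxx.
pose T := [:: 0; 1; 2]%N; pose U := [:: 3; 4; 5]%N.
(* All ordered pairs of disjoint facets. *)
pose L := [:: ([:: 0; 1; 6], U); ([:: 0; 2; 6], U); ([:: 1; 2; 6], U);
  ([:: 3; 4; 6], T); ([:: 3; 5; 6], T); ([:: 4; 5; 6], T);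
  (T, [:: 3; 4; 6]); (T, [:: 3; 5; 6]); (T, [:: 4; 5; 6]); (T, U);
  (U, [:: 0; 1; 6]); (U, [:: 0; 2; 6]); (U, [:: 1; 2; 6]); (U, T)]%N.
have : (s, t) \in L.
  have : all (fun s => all (fun t => lists_meet s t || ((s, t) \in L)) facet_lists) facet_lists.
    by vm_compute.
  by move/allP/(_ s sfl)/allP/(_ t tfl); rewrite (negbTE st).
case: w sz mw sw tw => [|x0 [|x1 [|x2 [|x3 [|x4 [|x5 [|x6 [|? ?]]]]]]]] // _ _.
rewrite /L !in_cons in_nil orbF !xpair_eqE => sw tw H; move: sw tw.
by repeat (case/orP: H => H; first (case/andP: H => /eqP-> /eqP->;
  rewrite /list_wt /facet_lists /= /lists_meet /=; lia));
  case/andP: H => /eqP-> /eqP->; rewrite /list_wt /facet_lists /= /lists_meet /=; lia.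
Qed.

(* When the facet s is added to the facets ts, the exponents that become standard
   for the second symbolic power are b + c with c supported on s and b = 0 or a
   vertex off s (encoded by a list of length at most 1); for given b these c form
   a translate of N^s, whose origin minimizes each coordinate separately. *)
Definition step_exponent (ts : seq (seq nat)) (s b : seq nat) : seq nat :=
  let cand v c := [seq (if x == v then c else if x \in s then 2 else x \in b : nat)%N
                  | x <- iota 0 7] in
  [seq (if v \in s
        then find (fun c => all (fun t => 2 <= list_wt 7 t (cand v c))%N ts) (iota 0 3)
        else v \in b : nat) | v <- iota 0 7].

(** The order is reversed because a filtration enlarges the ideal: exponents that become standard
    last enter it first, and the exponent 0 enters at the end. *)
Definition filtration_steps : seq (seq nat * seq nat) :=
  rev (flatten [seq [seq (step_exponent (take j facet_lists) s b, s)
      | b <- [::] :: [seq [:: v] | v <- iota 0 7 & v \notin s]]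
    | j <- iota 0 (size facet_lists), s <- [:: nth [::] facet_lists j]]).

Arguments filtration_steps : simpl never.

Definition list_le (u w : seq nat) : bool :=
  all (fun i => nth 0 u i <= nth 0 w i)%N (iota 0 7).

Definition in_ideal (seen : seq (seq nat)) (w : seq nat) : bool :=
  all (fun t => 2 <= list_wt 7 t w)%N facet_lists || has (fun u => list_le u w) seen.

Definition list_succ (w : seq nat) (j : nat) : seq nat :=
  [seq (j == i) + nth 0 w i | i <- iota 0 7]%N.

(** A finite test for [clean_filtration]. That w + c stays outside the ideal for all c supported on
    s is ensured by two conditions: w has weight less than 2 off s, and each generator added before
    exceeds w at some vertex off s. At the end the generator 1 must have been added. *)
Fixpoint check_steps (seen : seq (seq nat)) (W : seq (seq nat * seq nat)) : bool :=
  if W is (w, s) :: W' then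
    [&& all (fun j => (j \in s) || in_ideal seen (list_succ w j)) (iota 0 7),
        s \in facet_lists, (list_wt 7 s w < 2)%N,
        all (fun u => has (fun v => (v \notin s) && (nth 0 w v < nth 0 u v)%N) (iota 0 7)) seen
      & check_steps (w :: seen) W']
  else has (fun u => list_le u [::]) seen.

Notation mnm7 := (@list_mnm 7).

Lemma list_leP u w (m : 'X_{1..7}) : (forall i : 'I_7, m i = nth 0%N w i) ->
  (mnm7 u <= m)%MM = list_le u w.
Proof.
move=> mw; apply/mnm_lepP/allP => H i.
  by rewrite mem_iota => i7; have := H (Ordinal i7); rewrite mnmE mw.
by rewrite mnmE mw; apply: H; rewrite mem_iota ltn_ord.
Qed.

Lemma in_idealE seen w (m : 'X_{1..7}) : (forall i : 'I_7, m i = nth 0%N w i) ->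
  symbolic_exponent cone_two_triangles 2 m || has (fun u => (mnm7 u <= m)%MM) seen =
  in_ideal seen w.
Proof.
move=> mw; congr (_ || _); last by apply: eq_has => u; apply: list_leP.
apply/forall_inP/allP => [H t tfl|H F /facetsP[t tfl ->]].
  by rewrite -(wt_list _ mw) H // facetsE map_f.
by rewrite (wt_list _ mw) H.
Qed.

Lemma check_steps_clean seen W E : check_steps seen W ->
  (forall m, E m =
    symbolic_exponent cone_two_triangles 2 m || has (fun u => (mnm7 u <= m)%MM) seen) ->
  clean_filtration E [seq (mnm7 x.1, face x.2) | x <- W].
Proof.
elim: W seen E => [|[w s] W IH] seen E; cbn [check_steps map clean_filtration fst snd].
  case/hasP => u us u0 EE m; rewrite EE; apply/orP; right; apply/hasP; exists u => //.
  apply/mnm_lepP => i; rewrite mnmE; have /allP/(_ (val i)) := u0.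
  by rewrite mem_iota ltn_ord nth_nil => /(_ isT) ui; apply: leq_trans ui _.
case/and5P=> next sfl ws newer /IH{}IH EE; split.
- move=> j; rewrite in_list_face => js; rewrite EE (@in_idealE _ (list_succ w j)).
    have := allP next (val j); rewrite mem_iota ltn_ord (negbTE js).
    by move=> /(_ isT).
  move=> i; rewrite mnmDE mnm1E mnmE (nth_map 0%N) ?size_iota // nth_iota // addnC.
  by rewrite -val_eqE.
- move=> c c0; rewrite EE negb_or; apply/andP; split.
    apply/negP => /forall_inP/(_ (face s)); rewrite facetsE map_f // => /(_ isT).
    by rewrite wtD c0 addn0 wt_list_mnm leqNgt ws.
  apply/hasPn => u us; have /allP/(_ u us)/hasP[v] := newer.
  rewrite mem_iota => v7 /andP[vs uv]; apply/negP => /mnm_lepP/(_ (Ordinal v7)).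
  rewrite mnmDE !mnmE /= (wt_eq0P _ _ (introT eqP c0)) ?in_list_face // addn0.
  by rewrite leqNgt uv.
- by apply: IH => m; rewrite EE [has _ (w :: seen)]/= -!orbA [has _ _ || _]orbC.
Qed.

Lemma clean_cone_two_triangles :
  clean_filtration (symbolic_exponent cone_two_triangles 2)
    [seq (mnm7 x.1, face x.2) | x <- filtration_steps].
Proof.
apply: (@check_steps_clean [::]) => [|m]; last by rewrite orbF.
by vm_compute.
Qed.

Lemma facet_three F : F \in facets cone_two_triangles ->
  exists p q r, [/\ p != q, p != r, q != r & F = [set p; q; r]].
Proof.
case/facetsP => s /facet_listsP[]; case: s => // a [//|b [//|c [|//]]] _.
rewrite /= !andbT => /andP[ab bc] /and3P[a7 b7 c7] ->.
exists (Ordinal a7), (Ordinal b7), (Ordinal c7); rewrite -!val_eqE /=.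
split; try lia; by apply/setP => i; rewrite in_list_face !inE -!val_eqE orbA.
Qed.

Lemma filtration_steps_facet x : x \in filtration_steps -> face x.2 \in facets cone_two_triangles.
Proof.
have : all (fun x : seq nat * seq nat => x.2 \in facet_lists) filtration_steps by vm_compute.
by move/allP => H /H xfl; rewrite facetsE map_f.
Qed.

(** * A disconnected degree complex *)

Section Disconnected.
Variables (k : fieldType) (n : nat) (Delta : {set {set 'I_n}}) (l : nat).
Local Notation S := {mpoly k[n]}.
Local Notation FracS := {fraction S}.
Local Notation mnm := 'X_{1..n}.
Local Notation J := (mideal (symbolic_exponent Delta l) : S -> Prop).
Implicit Types (H : {set 'I_n}) (f g : S) (c : {ffun {set 'I_n} -> FracS}).

(* The degree complex at a of the l-th symbolic power is the disjoint union of the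
   simplices F and G, and it has at most one facet at a + U_(i). *)
Variables (F G : {set 'I_n}) (a : mnm).
Hypotheses (FD : F \in facets Delta) (GD : G \in facets Delta) (FG : [disjoint F & G]).
Hypotheses (Fa : (wt F a).+1 = l) (Ga : (wt G a).+1 = l).
Hypothesis Ha : forall H, H \in facets Delta -> H != F -> H != G -> (l <= wt H a)%N.
Hypothesis facet_neq0 : forall H, H \in facets Delta -> H != set0.

Lemma primary_coeff H m f : (wt H m < l)%N -> primary l H f -> f@_m = 0.
Proof. by move=> Hm; apply; rewrite -ltnNge. Qed.

Lemma facet_subset H H' : H \in facets Delta -> H' \in facets Delta -> H \subset H' -> H = H'.
Proof. by rewrite !inE => /maxsetP[_ maxH] /maxsetP[H'D _] HH'; rewrite (maxH H'). Qed.

(** Multiply by X^w with w equal to l on H and 0 elsewhere: it is regular modulo the component of H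
    and lies in all the others, since no other facet contains H. *)
Lemma nonzerodivisor_component u H :
  H \in facets Delta -> nonzerodivisor J u -> nonzerodivisor (primary l H) u.
Proof.
move=> HD regu g Hug; have primH := @upclosed_wt n H l.
pose w := (mesym1 H *+ l)%MM.
have wH : wt H w = 0%N.
  by apply/eqP/wt_eq0P => i /negbTE iH; rewrite mulmnE mnmE iH.
have colH f : primary l H ('X_[w] * f) <-> primary l H f.
  rewrite /primary mideal_colon // (@eq_mideal _ _ _ (fun m => l <= wt H m)%N) // => m.
  by rewrite wtD wH.
apply/colH; suff /symbolicP/(_ H HD) : J ('X_[w] * g) by [].
apply: regu; apply/symbolicP => H' H'D; have [_ _ HM] := primary_ideal k l H'.
have [->|HH'] := eqVneq H' H; first by rewrite mulrCA; apply/colH.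
rewrite mulrCA mulrC; apply: HM; apply/midealX.
have [i iH iH'] : exists2 i, i \in H & i \notin H'.
  apply/subsetPn; apply: contra HH' => HH'; apply/eqP; exact/esym/facet_subset.
apply: (@leq_trans (w i)); first by rewrite mulmnE mnmE iH mul1n.
by rewrite /wt (bigD1 i) //= leq_addr.
Qed.

(* Multiplying the element of the product of the S/P_H^l that is X^a at F and 0
   elsewhere by a polynomial without constant term lands in the image of S. *)
Lemma separator_multiple f : max_ideal f ->
  exists t, primary l F (t - f * 'X_[a]) /\
    forall H, H \in facets Delta -> H != F -> primary l H t.
Proof.
pose T f := exists t, primary l F (t - f * 'X_[a]) /\
  forall H, H \in facets Delta -> H != F -> primary l H t.
apply: (ideal_span_min (I := T)) => [|_ [i ->]].
  split.
  - exists 0; rewrite mul0r subr0; split=> [|H _ _]; first by case: (primary_ideal k l F).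
    by case: (primary_ideal k l H).
  - move=> f1 f2 [t1 [F1 H1]] [t2 [F2 H2]]; exists (t1 + t2); split=> [|H HD HF].
      by rewrite mulrDl opprD addrACA; case: (primary_ideal k l F) => _ ADD _; apply: ADD.
    by case: (primary_ideal k l H) => _ ADD _; apply: ADD; [apply: H1 | apply: H2].
  - move=> b f1 [t1 [F1 H1]]; exists (b * t1); split=> [|H HD HF].
      by rewrite -mulrA -mulrBr; case: (primary_ideal k l F) => _ _; apply.
    by case: (primary_ideal k l H) => _ _; apply; apply: H1.
have [iF|iF] := boolP (i \in F).
  exists ('X_i * 'X_[a]); rewrite subrr; split; first by case: (primary_ideal k l F).
  move=> H HD HF; rewrite -mpolyXD; apply/midealX; rewrite wtD wtU.
  have [->|HG] := eqVneq H G; first by rewrite (disjointFr FG iF) /= add1n Ga.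
  exact: leq_trans (Ha HD HF HG) (leq_addl _ _).
exists 0; rewrite sub0r; split=> [|H _ _]; last by case: (primary_ideal k l H).
apply: (ideal_opp (primary_ideal k l F)); rewrite -mpolyXD; apply/midealX.
by rewrite wtD wtU iF add1n Fa.
Qed.

(** For a regular pair u, v the multiples of the separator by u and v give t and t' with v t = u t'
    modulo J, so t = u g modulo J. Then g is X^a modulo P_F^l and 0 modulo P_G^l, while the
    coefficient at X^a is well defined modulo both. *)
Lemma regular_sequence_size s : regular_sequence J s -> (size s <= 1)%N.
Proof.
have idJ := symbolic_ideal k Delta l; case: s => [|u [|v s]] // [smax].
move=> /(weakly_regularP _ idJ) [regu [regv _]] _.
have [t [Ft tH]] := separator_multiple (smax 0%N isT).
have [t' [Ft' t'H]] := separator_multiple (smax 1%N isT).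
rewrite /= in Ft Ft'.
have /(ideal_add1P _ _ idJ)[g Jg] : ideal_add J [:: u] t.
  apply: regv; apply/(ideal_add1P _ _ idJ); exists t'; apply/symbolicP => H HD.
  have [_ _ HM] := primary_ideal k l H; have [HF|HF] := eqVneq H F.
    subst H; rewrite (_ : v * t - u * t' = v * (t - u * 'X_[a]) - u * (t' - v * 'X_[a])).
      by apply: (ideal_sub (primary_ideal k l F)); apply: HM.
    by ring.
  by apply: (ideal_sub (primary_ideal k l H)); apply: HM; [apply: tH | apply: t'H].
have GF : G != F.
  apply/eqP => E; have := FG; rewrite E -setI_eq0 setIid; exact/negP/facet_neq0.
have gF : primary l F ('X_[a] - g).
  apply: (nonzerodivisor_component FD regu).
  rewrite (_ : _ * _ = (t - u * g) - (t - u * 'X_[a])); last by ring.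
  by apply: (ideal_sub (primary_ideal k l F)) => //; move/symbolicP: Jg; apply.
have gG : primary l G g.
  apply: (nonzerodivisor_component GD regu); rewrite -[_ * _](subKr t).
  apply: (ideal_sub (primary_ideal k l G)); first exact: tH.
  by move/symbolicP: Jg; apply.
have Fa_lt : (wt F a < l)%N by rewrite -Fa.
have Ga_lt : (wt G a < l)%N by rewrite -Ga.
have /eqP := primary_coeff Fa_lt gF.
by rewrite mcoeffB mcoeffX eqxx (primary_coeff Ga_lt gG) subr0 oner_eq0.
Qed.

(** The coefficient of X^a in a fraction whose denominator is a power of X_i; [epsilon] picks a
    representation, on which the value does not depend. *)
Definition laurent_coeff (i : 'I_n) (q : FracS) : k :=
  epsilon (inhabits 0) (fun z => exists f N,
    q = tofrac f / tofrac ('X_i ^+ N) /\ z = f@_(a + U_(i) *+ N)).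

Lemma laurent_coeffE i f N :
  laurent_coeff i (tofrac f / tofrac ('X_i ^+ N)) = f@_(a + U_(i) *+ N).
Proof.
rewrite /laurent_coeff; set P := fun z => _.
have [g [M [E ->]]] : P (epsilon (inhabits 0) P).
  by apply: epsilon_spec; exists (f@_(a + U_(i) *+ N)), f, N.
have Xn0 M' : 'X_i ^+ M' != 0 :> S by rewrite expf_neq0 ?mpolyX_neq0.
move/frac_eq: E => /(_ (Xn0 N) (Xn0 M)) /(congr1 (mcoeff (a + U_(i) *+ N + U_(i) *+ M)%MM)).
rewrite !mpolyXn mcoeffMXD => ->.
by rewrite -addmA (addmC (U_(i) *+ N)%MM) addmA mcoeffMXD.
Qed.

Lemma in_localization_var (I : S -> Prop) i q : in_localization I [set i] q <->
  exists f N, I f /\ q = tofrac f / tofrac ('X_i ^+ N).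
Proof. by rewrite /in_localization monomial_of1. Qed.

(** The form is the difference of the coefficients of X^a at a vertex of F and at a vertex of G. It
    vanishes on coboundaries, and on f times the cocycle that is X^a on F and 0 elsewhere its value
    is the constant term of f. Hence the annihilator lies in the maximal ideal. *)
Lemma dual_local_cohomology_nonzero : dual_dim_ge J 1 0.
Proof.
have [/set0Pn[i0 i0F] /set0Pn[j0 j0G]] := (facet_neq0 FD, facet_neq0 GD).
have j0F : j0 \notin F by rewrite (disjointFl FG j0G).
pose phi c := laurent_coeff i0 (c [set i0]) - laurent_coeff j0 (c [set j0]).
have Xn0 i M : 'X_i ^+ M != 0 :> S by rewrite expf_neq0 ?mpolyX_neq0.
have cochain1 (I : S -> Prop) c i : cech_cochain I 1 c ->
    exists f N, I f /\ c [set i] = tofrac f / tofrac ('X_i ^+ N).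
  by move=> /(_ [set i]); rewrite cards1 eqxx => /in_localization_var.
have laurentD b c c' i : cech_cocycle J 1 c -> cech_cocycle J 1 c' ->
    laurent_coeff i ((cochain_scale b%:MP c + c') [set i]) =
    b * laurent_coeff i (c [set i]) + laurent_coeff i (c' [set i]).
  case=> /(cochain1 _ _ i)[f [N [_ cE]]] _ [/(cochain1 _ _ i)[f' [N' [_ c'E]]] _].
  rewrite ffunE ffunE cE c'E.
  have -> : tofrac b%:MP * (tofrac f / tofrac ('X_i ^+ N)) + tofrac f' / tofrac ('X_i ^+ N') =
      tofrac (b%:MP * f * 'X_i ^+ N' - (- f') * 'X_i ^+ N) / tofrac ('X_i ^+ (N + N')) :> FracS.
    rewrite exprD -frac_sub ?Xn0 // (tofracM b%:MP) tofracN mulNr opprK mulrA //.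
  rewrite !laurent_coeffE mulNr opprK mcoeffD !mpolyXn.
  have UD : (a + U_(i) *+ (N + N') = a + U_(i) *+ N + U_(i) *+ N')%MM.
    by apply/mnmP => x; rewrite !mnmDE !mulmnE mulnDr addnA.
  rewrite {1}UD mcoeffMXD mcoeffCM UD -addmA (addmC (U_(i) *+ N)%MM) addmA mcoeffMXD //.
have primeP : is_prime (fun f : S => f@_0 = 0).
  split=> [||f g]; first exact: mcoeff0_ideal.
    by rewrite mcoeff1 eqxx => /eqP; rewrite oner_eq0.
  by rewrite rmorphM /= => /eqP; rewrite mulf_eq0 => /orP[] /eqP; [left|right].
exists 0%N; split=> //; exists (fun _ f => f@_0 = 0); split=> // f annf.
pose c0 : {ffun {set 'I_n} -> FracS} :=
  [ffun A : {set 'I_n} => if (#|A| == 1%N) && (A \subset F) then tofrac 'X_[a] else 0].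
have c01 i : c0 [set i] = if i \in F then tofrac 'X_[a] else 0.
  by rewrite ffunE cards1 sub1set.
(* No facet of the degree complex at a contains both i and j, so X^a vanishes in the localization at
   X_i X_j. *)
have Jija i j : i \in F -> j \notin F -> J ('X_[a] * ('X_j * 'X_i) ^+ l).
  move=> iF jF; apply/symbolicP => H HD; have [_ _ HM] := primary_ideal k l H.
  have varH x : x \notin H -> primary l H ('X_x ^+ l : S).
    move=> xH; rewrite mpolyXn; apply/midealX.
    by rewrite /wt (bigD1 x) //= mulmnE mnm1E eqxx mul1n leq_addr.
  rewrite exprMn; have [jH|jH] := boolP (j \in H); last by rewrite mulrCA mulrC; apply/HM/varH.
  have [iH|iH] := boolP (i \in H); last by rewrite mulrA; apply/HM/varH.
  rewrite mulrC; apply: HM; apply/midealX; apply: Ha => //.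
    by apply: contraNneq jF => <-.
  by apply: contraTneq iH => ->; rewrite (disjointFr FG iF).
have c0_cocycle : cech_cocycle J 1 c0.
  split=> A; case: ifP => cA.
  - exists (if A \subset F then 'X_[a] else 0), 0%N; split=> //.
    by rewrite expr0 tofrac1 divr1 ffunE cA /=; case: ifP; rewrite ?tofrac0.
  - by rewrite ffunE cA.
  - have [i [j [ij ->]]] : exists i j : 'I_n, (i < j)%N /\ A = [set i; j].
      case/cards2P: cA => i [j [ij ->]]; have [lt|gt|/val_inj E] := ltngtP i j.
      - by exists i, j.
      - by exists j, i; rewrite setUC.
      - by rewrite E eqxx in ij.
    have J0 : in_localization J [set i; j] 0.
      exists 0, 0%N; split; last by rewrite tofrac0 mul0r.
      by case: (symbolic_ideal k Delta l).
    have nij : i \notin [set j] by rewrite inE neq_ltn ij.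
    have monE : monomial_of k [set i; j] = 'X_i * 'X_j.
      by rewrite /monomial_of big_setU1 //= big_set1.
    have XF0 : tofrac (('X_i * 'X_j) ^+ l) != 0 :> FracS.
      by rewrite tofrac_eq0 expf_neq0 // mulf_neq0 ?mpolyX_neq0.
    rewrite cech_diff2 // !c01; case: ifP => jF; case: ifP => iF; rewrite ?subrr //.
    + rewrite subr0; exists ('X_[a] * ('X_i * 'X_j) ^+ l), l; split; first exact: Jija (negbT iF).
      by rewrite monE tofracM mulfK.
    + rewrite sub0r; exists (- ('X_[a] * ('X_i * 'X_j) ^+ l)), l; split.
        by apply: (ideal_opp (symbolic_ideal k Delta l)); rewrite ['X_i * _]mulrC; apply: Jija (negbT jF).
      by rewrite monE tofracN tofracM mulNr mulfK.
  - rewrite ffunE big1 // => i iA; rewrite ffunE (_ : #|A :\ i| == 1%N = false) ?mulr0 //.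
    by move: cA; rewrite (cardsD1 i A) iA.
have in_J i H g N : i \in H -> H \in facets Delta -> (wt H a < l)%N -> J g ->
    g@_(a + U_(i) *+ N) = 0.
  move=> iH HD Hla /symbolicP/(_ H HD); apply: primary_coeff.
  by rewrite wtD (_ : wt H (U_(i) *+ N) = 0%N) ?addn0 //; apply/eqP/wt_eq0P => x xH;
    rewrite mulmnE mnm1E; case: eqP xH => // <-; rewrite iH.
have phiP : dual_local_cohomology J 1 phi.
  split=> [b c c' cc c'c|c cc [b [b0 bc]]|].
  - by rewrite /phi !laurentD //; ring.
  - have [g0 [N0 [_ bE]]] : in_localization (@whole_ring k n) set0 (b set0).
      by have := b0 set0; rewrite cards0.
    have {}bE : b set0 = tofrac g0 by rewrite bE /monomial_of big_set0 expr1n tofrac1 divr1.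
    have key i H : i \in H -> H \in facets Delta -> (wt H a < l)%N ->
        laurent_coeff i (c [set i]) = g0@_a.
      move=> iH HD Hla; have [g [N [Jg gE]]] := cochain1 _ _ i bc.
      have : c [set i] = tofrac (g * 1 - (- g0) * 'X_i ^+ N) / tofrac ('X_i ^+ N * 1).
        rewrite -frac_sub ?Xn0 ?oner_eq0 // -gE.
        by rewrite ffunE [X in _ + X + _]ffunE cech_diff1 bE tofrac1 divr1 tofracN opprK subrK.
      rewrite !mulr1 => ->; rewrite laurent_coeffE mulNr opprK mcoeffD (in_J i H) //.
      by rewrite mpolyXn mcoeffMXD add0r.
    by rewrite /phi (key _ _ i0F FD) -?Fa // (key _ _ j0G GD) -?Ga // subrr.
  (* The form only sees X^a, so it lives in the single degree [mdeg a]. *)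
  - exists (mdeg a) => e c ea [cc _] hom.
    have key i : laurent_coeff i (c [set i]) = 0.
      have [->|[g [m [N [gm eE ->]]]]] := hom [set i].
        by have := laurent_coeffE i 0 0; rewrite tofrac0 mul0r mcoeff0.
      rewrite monomial_of1 laurent_coeffE (dhomog_nemf_coeff gm) //.
      apply: contraTneq ea => mE; have {}mE : mdeg (a + U_(i) *+ N)%MM = m := mE.
      by move: eE mE; rewrite mdegD mdegMn mdeg1 mul1n cards1; lia.
    by rewrite /phi !key subrr.
have := annf phi phiP c0 c0_cocycle.
rewrite /phi !ffunE !cards1 !sub1set i0F (negbTE j0F) mulr0 /=.
have -> : tofrac f * tofrac 'X_[a] = tofrac (f * 'X_[a]) / tofrac ('X_i0 ^+ 0) :> FracS.
  by rewrite expr0 tofrac1 divr1 tofracM.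
have -> : laurent_coeff j0 0 = 0.
  by have := laurent_coeffE j0 0 0; rewrite tofrac0 mul0r mcoeff0.
by rewrite subr0 laurent_coeffE mulm0n (addmC a) mcoeffMXD.
Qed.

End Disconnected.

(** * The theorem *)

Section Example.
Variable k : fieldType.
Local Notation S := {mpoly k[7]}.
Local Notation Delta := cone_two_triangles.
Local Notation symb l := (mideal (symbolic_exponent Delta l) : S -> Prop).
Local Notation F := (face [:: 0; 1; 2]%N).
Local Notation G := (face [:: 3; 4; 5]%N).
Local Notation a := (mnm7 [:: 1; 1; 1; 1; 1; 1; 0]%N).

Lemma facet_F : F \in facets Delta. Proof. by rewrite facetsE map_f. Qed.
Lemma facet_G : G \in facets Delta. Proof. by rewrite facetsE map_f. Qed.

Lemma facet_neq0 H : H \in facets Delta -> H != set0.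
Proof. by move=> /card_facet Hc; rewrite -card_gt0 Hc. Qed.

Lemma disjoint_FG : [disjoint F & G].
Proof.
rewrite -setI_eq0; apply/eqP/setP => i; rewrite in_setI !in_list_face in_set0.
by case: i => -[|[|[|[|[|[|[|]]]]]]].
Qed.

Lemma other_facets H : H \in facets Delta -> H != F -> H != G -> (4 <= wt H a)%N.
Proof.
case/facetsP => s sfl -> sF sG; rewrite wt_list_mnm.
have : all (fun s => [|| s == [:: 0; 1; 2]%N, s == [:: 3; 4; 5]%N
    | (4 <= list_wt 7 s [:: 1; 1; 1; 1; 1; 1; 0])%N]) facet_lists by vm_compute.
move/allP/(_ s sfl); case/or3P => // /eqP E; by rewrite E eqxx in sF sG.
Qed.

Lemma wt_F : (wt F a).+1 = 4. Proof. by rewrite wt_list_mnm. Qed.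
Lemma wt_G : (wt G a).+1 = 4. Proof. by rewrite wt_list_mnm. Qed.

Lemma symbolic_mcoeff0 l (f : S) : symb l.+1 f -> f@_0 = 0.
Proof.
move=> Jf; apply: Jf; apply/negP => /forall_inP/(_ F facet_F).
by rewrite (eqP (_ : wt F 0%MM == 0%N)) //; apply/wt_eq0P => i _; rewrite mnm0E.
Qed.

Lemma elem_sym_max (f : S) : f \in [:: elem_sym k 7 1; elem_sym k 7 2; elem_sym k 7 3] -> max_ideal f.
Proof. by rewrite !inE => /or3P[] /eqP->; apply/max_idealE/mcoeff0_elem_sym. Qed.

Lemma elem_sym_facet H : H \in facets Delta ->
  weakly_regular (@face_prime k 7 H) [:: elem_sym k 7 1; elem_sym k 7 2; elem_sym k 7 3].
Proof. by case/facet_three => p [q [r [pq pr qr ->]]]; apply: elem_sym_regular. Qed.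

Lemma elem_sym_symbolic2 :
  regular_sequence (symb 2) [:: elem_sym k 7 1; elem_sym k 7 2; elem_sym k 7 3].
Proof.
apply: regular_sequence_intro; first exact: symbolic_ideal.
- exact: symbolic_mcoeff0.
- exact: elem_sym_max.
apply: clean_filtration_regular clean_cone_two_triangles _; first exact: upclosed_symbolic.
by move=> _ /mapP[x /filtration_steps_facet xF ->]; apply: elem_sym_facet.
Qed.

Lemma symbolic2_chain_size (J : S -> Prop) s : is_ideal J ->
  (forall f, symb 2 f -> J f) -> regular_chain J s -> (size s <= 3)%N.
Proof.
move=> idJ sJ; apply: (@regular_chain_size _ _ _ (facets Delta) _ 2 _ _ idJ sJ).
  move=> m; rewrite negb_forall => /existsP[H]; rewrite negb_imply -ltnNge => /andP[HD Hm].
  by exists H.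
by move=> H /card_facet ->.
Qed.

Lemma symbolic2_cohen_macaulay : cohen_macaulay (symb 2).
Proof.
have idJ := symbolic_ideal k Delta 2.
exists 3; split; split.
- by exists [:: elem_sym k 7 1; elem_sym k 7 2; elem_sym k 7 3]; split; first exact: elem_sym_symbolic2.
- move=> s [_ /(weakly_regularP _ idJ) regs N1].
  exact: (symbolic2_chain_size idJ) (weakly_regular_chain regs N1).
(* The faces 012, 01, 0 and the empty face give a chain of four primes; step i gains the variable
   with index 2 - i. *)
- pose A i := face (take (3 - i) [:: 0; 1; 2]%N).
  exists (fun i => face_prime (A i)); split=> [i _|f|i i3]; first exact: face_prime_prime.
    by move=> /symbolicP/(_ F facet_F) Ff m Fm; apply: Ff; apply: contra Fm; apply: leq_trans.
  split.
    move=> f; apply: face_prime_subset; apply: face_subset; apply/allP => x.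
    by case: i i3 => [|[|[|]]] // _; rewrite !inE; do ?[case/orP]; move/eqP->.
  have i7 : (2 - i < 7)%N by rewrite ltnS (leq_trans (leq_subr _ _)).
  exists 'X_(Ordinal i7); rewrite !face_primeX !in_list_face /=.
  by split; [|move/negP]; case: i i3 {i7} => [|[|[|]]].
- move=> l [P [primeP JP chP]].
  have [s chs <-] := prime_chain_regular primeP chP.
  by apply: (symbolic2_chain_size _ JP chs); case: (primeP 0%N).
Qed.

Lemma elem_sym1_facet H : H \in facets Delta -> ~ face_prime H (elem_sym k 7 1).
Proof.
move/facet_neq0/set0Pn => [i iH] /(face_prime_subset (F := [set i])).
by rewrite sub1set => /(_ iH); apply: elem_sym1_notin.
Qed.

Lemma symbolic4_depth : depth_eq (symb 4) 1.
Proof.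
split; last first.
  exact: regular_sequence_size facet_F facet_G disjoint_FG wt_F wt_G other_facets facet_neq0.
exists [:: elem_sym k 7 1]; split=> //; apply: regular_sequence_intro.
- exact: symbolic_ideal.
- exact: symbolic_mcoeff0.
- by move=> f; rewrite inE => /eqP->; apply: elem_sym_max; rewrite mem_head.
- by split=> //; apply: symbolic_nonzerodivisor => H; apply: elem_sym1_facet.
Qed.

Lemma symbolic5_depth : depth_ge (symb 5) 2.
Proof.
exists [:: elem_sym k 7 1; elem_sym k 7 2]; split=> //; apply: regular_sequence_intro.
- exact: symbolic_ideal.
- exact: symbolic_mcoeff0.
- by move=> f f12; apply: elem_sym_max; move: f12; rewrite !inE => /orP[]->; rewrite ?orbT.
apply: linked_weakly_regular linked_cone_two_triangles _ _; first exact: elem_sym1_notin.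
move=> H HD; split; first exact: facet_neq0.
exact: (@weakly_regular_cat k 7 _ [:: _; _] [:: _] (elem_sym_facet HD)).
Qed.

Lemma facet_gt1 H : H \in facets Delta -> (1 < #|H|)%N.
Proof. by move/card_facet ->. Qed.

Lemma symbolic_H0 l m : ~ dual_dim_ge (symb l) 0 m.
Proof. exact: dual_dim_acyclic (cech_H0 facet_gt1). Qed.

Lemma symbolic4_Serre : Serre_depth_eq 2 (symb 4) 1.
Proof.
split=> [|[/symbolic_H0|]//].
(* The required bound on the dimension of K^1 is 1 - 2 + 1 = 0. *)
exact: dual_local_cohomology_nonzero facet_F facet_G disjoint_FG wt_F wt_G other_facets facet_neq0.
Qed.

Lemma symbolic5_Serre : Serre_depth_ge 2 (symb 5) 2.
Proof.
move=> [/symbolic_H0//|[|//]] H1; exfalso; apply: dual_dim_acyclic H1 => c.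
exact: (cech_H1 facet_gt1 linked_cone_two_triangles).
Qed.

End Example.

Theorem theorem1p6 (k : fieldType) :
  exists (n : nat) (Delta : {set {set 'I_n}}) (d : nat),
    let I := Stanley_Reisner k Delta in
    [/\ simplicial_complex Delta, ~ cone Delta,
        complex_dim Delta = d%:Z - 1 & 2 <= d%:Z - 1] /\
    [/\ pure Delta /\ shellable Delta,
        cohen_macaulay (symbolic_power I 2),
        depth_eq (symbolic_power I d.+1) 1 /\
          depth_ge (symbolic_power I d.+2) 2
      & Serre_depth_eq 2 (symbolic_power I d.+1) 1 /\
          Serre_depth_ge 2 (symbolic_power I d.+2) 2].
Proof.
exists 7, cone_two_triangles, 3; cbv zeta.
rewrite !(symbolic_powerE k complex_cone_two_triangles); split; split=> //.
- exact: complex_cone_two_triangles.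
- exact: not_cone_cone_two_triangles.
- exact: dim_cone_two_triangles.
- by split; [apply: pure_cone_two_triangles | apply: shellable_cone_two_triangles].
- exact: symbolic2_cohen_macaulay.
- by split; [apply: symbolic4_depth | apply: symbolic5_depth].
- by split; [apply: symbolic4_Serre | apply: symbolic5_Serre].
Qed.
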